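(* Let $Y_1,Y_2\subsetneq\mathbb{C}$ and $\Omega\subset\mathbb{C}$ be domains. Suppose that for every point $b\in Y_2$ there exist a point $a\in Y_1$ and a holomorphic covering map $g_b:Y_1\setminus\{a\}\to Y_2\setminus\{b\}$ which extends to a holomorphic function $g_b:Y_1\to Y_2$ with $g_b(a)=b$ and $g_b'(a)\neq0$. Then for every $b\in Y_2$ and every $a\in Y_1$ for which such a map $g_b$ exists, $$\mathscr{C}_{\Omega}^{Y_1,a}(w)\leq \mathscr{C}_{\Omega}^{Y_2,b}(w)\quad\text{for all } w\in\Omega.$$
   Context: $\mathbb{D}=\{z\in\mathbb{C}:|z|<1\}$. For domains $\Omega\subset\mathbb{C}$, $Y\subsetneq\mathbb{C}$, and points $w\in\Omega$, $s\in Y$, let $\mathcal{H}^s_w(\Omega,Y)$ be the set of holomorphic maps $h:\Omega\to Y$ with $h(w)=s$ and $h(z)\neq s$ for all $z\in\Omega\setminus\{w\}$. For a domain $Y\subsetneq\mathbb{C}$ and $v\in Y$, the Hurwitz density is $\eta_Y(v)=2/r_Y(v)$, where $r_Y(v)=\max\{h'(0): h:\mathbb{D}\to Y \text{ holomorphic},\ h(0)=v,\ h(z)\neq v \text{ for } z\in\mathbb{D}\setminus\{0\},\ h'(0)>0\}$. The Carathéodory density of the Hurwitz metric of $\Omega$ relative to $Y$ is $\mathscr{C}_{\Omega}^{Y,s}(w)=\sup\{\eta_Y(h(w))|h'(w)| : h\in\mathcal{H}^s_w(\Omega,Y)\}$, defined to be $0$ if $\mathcal{H}^s_w(\Omega,Y)=\emptyset$.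 *)

(* Defs.v *)
From Stdlib Require Import Reals ClassicalEpsilon.
From Coquelicot Require Import Coquelicot.
Open Scope R_scope.

Definition connected_set (U : C -> Prop) : Prop :=
  forall A B : C -> Prop, open A -> open B ->
    (forall z, U z -> A z \/ B z) ->
    (forall z, U z -> A z -> B z -> False) ->
    (forall z, U z -> A z) \/ (forall z, U z -> B z).

Definition is_domain (U : C -> Prop) : Prop :=
  open U /\ (exists z, U z) /\ connected_set U.

Definition proper_subset (Y : C -> Prop) : Prop := exists p : C, ~ Y p.

Definition holomorphic_on (U : C -> Prop) (f : C -> C) : Prop :=
  forall z, U z -> ex_derive f z.

Definition maps_into (U V : C -> Prop) (f : C -> C) : Prop :=
  forall z, U z -> V (f z).

Definition disc (z : C) : Prop := Cmod z < 1.

Definition Hset (Omega Y : C -> Prop) (w s : C) (h : C -> C) : Prop :=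
  holomorphic_on Omega h /\ maps_into Omega Y h /\ h w = s /\
  (forall z, Omega z -> z <> w -> h z <> s).

(* r_Y(v) = max { h'(0) : h : D -> Y holomorphic, h(0)=v, h(z) <> v for z <> 0,
   h'(0) > 0 } ; the max is taken as the supremum (it is attained). *)
Definition r_Y (Y : C -> Prop) (v : C) : R :=
  real (Lub_Rbar (fun x : R => exists h : C -> C,
     Hset disc Y (RtoC 0) v h /\ 0 < x /\ is_derive h (RtoC 0) (RtoC x))).

Definition eta_Y (Y : C -> Prop) (v : C) : R := 2 / r_Y Y v.

Definition cara (Omega Y : C -> Prop) (s w : C) : Rbar :=
  match excluded_middle_informative (exists h, Hset Omega Y w s h) with
  | left _ => Lub_Rbar (fun x : R => exists h : C -> C, exists l : C,
                 Hset Omega Y w s h /\ is_derive h w l /\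
                 x = eta_Y Y (h w) * Cmod l)
  | right _ => Finite 0
  end.

Definition homeo_onto (f : C -> C) (U V : C -> Prop) : Prop :=
  exists finv : C -> C,
    (forall z, U z -> V (f z) /\ finv (f z) = z) /\
    (forall y, V y -> U (finv y) /\ f (finv y) = y) /\
    (forall z, U z -> continuous f z) /\
    (forall y, V y -> continuous finv y).

(* g is a covering map from A onto B (A, B open subsets of C) *)
Definition covering_map (g : C -> C) (A B : C -> Prop) : Prop :=
  maps_into A B g /\
  (forall z, A z -> continuous g z) /\
  (forall y, B y -> exists x, A x /\ g x = y) /\
  (forall y, B y -> exists V : C -> Prop, open V /\ V y /\
     (forall v, V v -> B v) /\
     exists (I : Type) (U : I -> C -> Prop),
       (forall i, open (U i)) /\
       (forall i j z, U i z -> U j z -> i = j) /\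
       (forall z, (A z /\ V (g z)) <-> exists i, U i z) /\
       (forall i, homeo_onto g (U i) V)).

Definition remove_pt (Y : C -> Prop) (a : C) : C -> Prop :=
  fun z => Y z /\ z <> a.

Definition good_map (Y1 Y2 : C -> Prop) (a b : C) (g : C -> C) : Prop :=
  holomorphic_on Y1 g /\ maps_into Y1 Y2 g /\ g a = b /\
  (exists l : C, is_derive g a l /\ l <> RtoC 0) /\
  covering_map g (remove_pt Y1 a) (remove_pt Y2 b).

(* Main.v *)
Require Import Defs.
From Stdlib Require Import Reals Lra Psatz ClassicalEpsilon.
From Coquelicot Require Import Coquelicot.
Open Scope R_scope.

(* A map [f] from the disc to [Y2] with [f 0 = b] that avoids [b] elsewhere lifts through [g] to a
   map [F] into [Y1] with [F 0 = a]: the punctured disc is not simply connected, but near [0] the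
   local inverse of [g] at [a] gives a single-valued lift, which is then continued outwards along
   the radii. Lifts divide derivatives at [0] by [g'(a)] and compositions multiply them by it, so
   [r_{Y2}(b) = |g'(a)| r_{Y1}(a)], that is [eta_{Y1}(a) = eta_{Y2}(b) |g'(a)|]. Hence [h] and
   [g o h] contribute the same number to the two suprema.
   Lifts are holomorphic because [g' <> 0] on [Y1]. This rests on Goursat's theorem for rectangles,
   transported to circles by the exponential: it yields circle integral formulas for [g'(c)]
   and, where [g] is injective and [g'(c) <> 0], for [1 / g'(c)]; both are continuous in [c]. *)

(** * Complex differentiability and the exponential *)

(** The covering condition is topological and says nothing over [b], which shapes the proof in two
    ways. Away from [a] it only makes [g] locally injective, so [g' <> 0] there has to be derived
    from injectivity. And since [f 0 = b], continuation has to start from an inverse of [g] near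
    [a], defined over a full neighbourhood of [b]. Uniqueness of lifts, by contrast, needs only
    local injectivity of [g], which holds at [a] as well; so lifts can be compared on convex sets
    that contain [0], and the puncture causes no monodromy. The class defining [r_Y] demands
    [h'(0) > 0], whereas [g'(a)] is any nonzero complex number. Lifts and compositions are therefore
    precomposed with a rotation of the disc, which leaves [|g'(a)|] as the only trace of [g'(a)].
    Lifting is applied to maps of the disc only. A map from [Omega] to [Y2] need not lift when
    [Omega] is not simply connected, so the maps [h] are merely composed with [g], and the
    conclusion is an inequality. *)

Lemma locally_C_iff (z : C) (P : C -> Prop) :
  locally z P <-> exists d, 0 < d /\ forall y : C, Cmod (y - z) < d -> P y.
Proof.
  split.
  - intros H. apply (proj1 (locally_C z P)) in H.
    destruct H as [d Hd]. exists d; split; [apply cond_pos|].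
    intros y Hy. apply Hd. exact Hy.
  - intros [d [Hd H]]. apply (proj2 (locally_C z P)).
    exists (mkposreal d Hd). intros y Hy. apply H. exact Hy.
Qed.

Lemma open_C_iff (U : C -> Prop) :
  open U <-> forall z, U z -> exists d, 0 < d /\ forall y : C, Cmod (y - z) < d -> U y.
Proof.
  split; intros H z Hz.
  - apply locally_C_iff. apply H. exact Hz.
  - apply locally_C_iff. apply H. exact Hz.
Qed.

Lemma continuous_C_iff (f : C -> C) (z : C) :
  continuous f z <-> forall e, 0 < e -> exists d, 0 < d /\
    forall y : C, Cmod (y - z) < d -> Cmod (f y - f z) < e.
Proof.
  split.
  - intros H e He. apply locally_C_iff.
    apply (H (fun y => Cmod (y - f z) < e)). apply locally_C_iff.
    exists e; split; auto.
  - intros H P HP. apply locally_C_iff in HP. destruct HP as [e [He HP]].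
    destruct (H e He) as [d [Hd H']]. apply locally_C_iff.
    exists d; split; auto.
Qed.

Lemma continuous_R_C_iff (f : R -> C) (t : R) :
  continuous f t <-> forall e, 0 < e -> exists d, 0 < d /\
    forall s, Rabs (s - t) < d -> Cmod (f s - f t) < e.
Proof.
  split.
  - intros H e He.
    assert (HP : locally (f t) (fun y => Cmod (y - f t) < e)).
    { apply locally_C_iff. exists e; auto. }
    destruct (H _ HP) as [d Hd]. exists d; split; [apply cond_pos|].
    intros s Hs. apply Hd. exact Hs.
  - intros H P HP. apply locally_C_iff in HP. destruct HP as [e [He HP]].
    destruct (H e He) as [d [Hd H']].
    exists (mkposreal d Hd). intros s Hs. apply HP, H'. exact Hs.
Qed.

Lemma is_derive_C_iff (f : C -> C) (z l : C) :
  is_derive f z l <-> forall e, 0 < e -> exists d, 0 < d /\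
    forall y : C, Cmod (y - z) < d -> Cmod (f y - f z - l * (y - z)) <= e * Cmod (y - z).
Proof.
  split.
  - intros [_ H] e He.
    assert (Hz : is_filter_lim (T:=AbsRing_NormedModule C_AbsRing) (locally (T:=AbsRing_UniformSpace C_AbsRing) z) z) by (intros P HP; exact HP).
    specialize (H z Hz (mkposreal e He)).
    destruct H as [d H]. exists d; split; [apply cond_pos|].
    intros y Hy. specialize (H y Hy).
    change (Cmod (minus (minus (f y) (f z)) (scal (minus y z) l)) <= e * Cmod (y - z)) in H.
    replace (f y - f z - l * (y - z))%C with (minus (minus (f y) (f z)) (scal (minus y z) l)).
    exact H.
    change (f y - f z - (y - z) * l = f y - f z - l * (y - z))%C. ring.
  - intros H. split; [apply is_linear_scal_l|].
    intros x Hx. assert (x = z) as ->.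
    { symmetry. apply (is_filter_lim_locally_unique (K:=C_AbsRing) (V:=AbsRing_NormedModule C_AbsRing)). exact Hx. }
    intros [e He]. destruct (H e He) as [d [Hd H']].
    exists (mkposreal d Hd).
    intros y Hy.
    change (Cmod (minus (minus (f y) (f z)) (scal (minus y z) l)) <= e * Cmod (y - z)).
    specialize (H' y Hy).
    replace (minus (minus (f y) (f z)) (scal (minus y z) l)) with (f y - f z - l * (y - z))%C.
    exact H'.
    change (f y - f z - l * (y - z) = f y - f z - (y - z) * l)%C. ring.
Qed.

Lemma is_derive_C_continuous (f : C -> C) (z l : C) : is_derive f z l -> continuous f z.
Proof.
  intros H. apply continuous_C_iff. intros e He.
  destruct (proj1 (is_derive_C_iff f z l) H 1 Rlt_0_1) as [d [Hd H']].
  assert (Hl := Cmod_ge_0 l).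
  assert (Hq : 0 < e / (Cmod l + 2)) by (apply Rdiv_lt_0_compat; lra).
  exists (Rmin d (e / (Cmod l + 2))). split; [apply Rmin_glb_lt; lra|].
  intros y Hy.
  assert (H1 := H' y (Rlt_le_trans _ _ _ Hy (Rmin_l _ _))).
  assert (H2 := Rlt_le_trans _ _ _ Hy (Rmin_r _ _)).
  replace (f y - f z)%C with ((f y - f z - l * (y - z)) + l * (y - z))%C by ring.
  apply Rle_lt_trans with (1 := Cmod_triangle _ _). rewrite Cmod_mult.
  apply Rlt_div_r in H2; [|lra].
  assert (H3 := Cmod_ge_0 (y - z)). nra.
Qed.

Lemma ex_derive_C_continuous (f : C -> C) (z : C) : ex_derive f z -> continuous f z.
Proof. intros [l H]. exact (is_derive_C_continuous f z l H). Qed.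

Lemma is_derive_C_ext_loc (f g : C -> C) (z l : C) (d : R) : 0 < d ->
  (forall y, Cmod (y - z) < d -> f y = g y) -> is_derive f z l -> is_derive g z l.
Proof.
  intros Hd E H. apply is_derive_C_iff. intros e He.
  destruct (proj1 (is_derive_C_iff f z l) H e He) as [d' [Hd' H']].
  exists (Rmin d d'). split; [apply Rmin_glb_lt; lra|]. intros y Hy.
  rewrite <- !E. apply H'. eapply Rlt_le_trans; [exact Hy|apply Rmin_r].
  replace (z - z)%C with (RtoC 0) by ring. rewrite Cmod_0; exact Hd.
  eapply Rlt_le_trans; [exact Hy|apply Rmin_l].
Qed.

(* Coquelicot offers two non-convertible normed modules on [C] as codomains of [is_derive]. *)
Lemma is_derive_C_AbsRing (f : C -> C) (z l : C) :
  is_derive (V:=AbsRing_NormedModule C_AbsRing) f z l <-> is_derive (V:=C_NormedModule) f z l.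
Proof. split; (intros [_ H]; split; [apply is_linear_scal_l|exact H]). Qed.

Lemma is_derive_C_mult (f g : C -> C) (z lf lg : C) :
  is_derive f z lf -> is_derive g z lg ->
  is_derive (fun y => f y * g y)%C z (lf * g z + f z * lg)%C.
Proof.
  rewrite <- !is_derive_C_AbsRing. intros Hf Hg.
  exact (is_derive_mult (K:=C_AbsRing) f g z lf lg Hf Hg Cmult_comm).
Qed.

Lemma is_derive_C_comp (f g : C -> C) (z lf lg : C) :
  is_derive f (g z) lf -> is_derive g z lg ->
  is_derive (fun y => f (g y)) z (lg * lf)%C.
Proof.
  intros Hf Hg. apply is_derive_C_AbsRing in Hg.
  exact (is_derive_comp (K:=C_AbsRing) f g z lf lg Hf Hg).
Qed.

Lemma is_derive_C_affine (p q z : C) : is_derive (fun y : C => p + q * y)%C z q.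
Proof.
  apply is_derive_C_iff. intros e He. exists 1. split; [lra|]. intros y _.
  replace (p + q * y - (p + q * z) - q * (y - z))%C with (RtoC 0) by ring.
  rewrite Cmod_0. assert (H := Cmod_ge_0 (y - z)). nra.
Qed.

Lemma is_derive_C_minus (f g : C -> C) (z lf lg : C) :
  is_derive f z lf -> is_derive g z lg -> is_derive (fun y => f y - g y)%C z (lf - lg)%C.
Proof. intros Hf Hg. exact (is_derive_minus (K:=C_AbsRing) (V:=C_NormedModule) f g z lf lg Hf Hg). Qed.

Lemma Cmod_triangle_inv (x y : C) : Cmod x - Cmod y <= Cmod (x - y).
Proof.
  assert (H := Cmod_triangle (x - y) y). replace (x - y + y)%C with x in H by ring. lra.
Qed.

Lemma Cmod_minus_sym (x y : C) : Cmod (x - y) = Cmod (y - x).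
Proof. rewrite <- Cmod_opp. f_equal. ring. Qed.

Lemma Cmod_minus_0 (z : C) : Cmod (z - z) = 0.
Proof. replace (z - z)%C with (RtoC 0) by ring. apply Cmod_0. Qed.

Lemma is_derive_C_inv (z : C) : z <> 0 -> is_derive Cinv z (- / (z * z))%C.
Proof.
  intros Hz. assert (Hm := proj1 (Cmod_gt_0 z) Hz).
  apply is_derive_C_iff. intros e He.
  set (m := Cmod z) in *.
  exists (Rmin (m / 2) (e * (m * m * m) / 2)).
  assert (0 < m * m * m) by (repeat apply Rmult_lt_0_compat; lra).
  split; [apply Rmin_glb_lt; nra|]. intros y Hy.
  assert (H1 := Rlt_le_trans _ _ _ Hy (Rmin_l _ _)).
  assert (H2 := Rlt_le_trans _ _ _ Hy (Rmin_r _ _)).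
  assert (H3 := Cmod_triangle_inv z y). rewrite Cmod_minus_sym in H3. fold m in H3.
  assert (Hy0 : y <> 0). { intros ->. rewrite Cmod_0 in H3. lra. }
  replace (/ y - / z - - / (z * z) * (y - z))%C with ((y - z) * (y - z) / (z * z * y))%C
    by (field; split; assumption).
  rewrite Cmod_div by (repeat apply Cmult_neq_0; assumption).
  rewrite !Cmod_mult. fold m. set (q := Cmod (y - z)) in *.
  assert (0 <= q) by apply Cmod_ge_0.
  assert (0 < m * m * Cmod y) by (repeat apply Rmult_lt_0_compat; lra).
  apply Rle_div_l; [lra|].
  replace (e * q * (m * m * Cmod y)) with (q * (e * (m * m * Cmod y))) by ring.
  apply Rmult_le_compat_l; [lra|].
  assert (e * (m * m * (m/2)) <= e * (m * m * Cmod y)); [|nra].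
  apply Rmult_le_compat_l; [lra|]. apply Rmult_le_compat_l; nra.
Qed.

Lemma is_derive_C_div (f g : C -> C) (z lf lg : C) : g z <> 0 ->
  is_derive f z lf -> is_derive g z lg -> ex_derive (fun y => f y / g y)%C z.
Proof.
  intros Hz Hf Hg. eexists. apply is_derive_C_mult; [exact Hf|].
  apply (is_derive_C_comp Cinv g); [apply is_derive_C_inv; exact Hz|exact Hg].
Qed.

Lemma Cmod_le_abs (z : C) : Cmod z <= Rabs (Re z) + Rabs (Im z).
Proof.
  replace z with (RtoC (Re z) + Ci * RtoC (Im z))%C at 1.
  - apply Rle_trans with (1 := Cmod_triangle _ _).
    rewrite Cmod_mult, Cmod_Ci, !Cmod_R. lra.
  - destruct z as [x y]. unfold RtoC, Ci, Cmult, Cplus; simpl. f_equal; ring.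
Qed.

Lemma Rabs_Im_le (z : C) : Rabs (Im z) <= Cmod z.
Proof. eapply Rle_trans; [apply Rmax_r|apply Rmax_Cmod]. Qed.

Definition cexp (u : C) : C := (exp (Re u) * cos (Im u), exp (Re u) * sin (Im u)).

Lemma cexp_plus (u v : C) : cexp (u + v) = (cexp u * cexp v)%C.
Proof.
  destruct u as [x y], v as [x' y']. unfold cexp, Cmult; simpl.
  rewrite exp_plus, cos_plus, sin_plus. f_equal; ring.
Qed.

Lemma Cmod_cexp (u : C) : Cmod (cexp u) = exp (Re u).
Proof.
  unfold Cmod, cexp; simpl.
  replace (_ + _) with (exp (Re u) * exp (Re u)).
  - apply sqrt_square. left; apply exp_pos.
  - assert (H := sin2_cos2 (Im u)). unfold Rsqr in H. nra.
Qed.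

Lemma derivable_pt_lim_le (f : R -> R) (x l : R) : derivable_pt_lim f x l ->
  forall e, 0 < e -> exists d, 0 < d /\
    forall h, Rabs h < d -> Rabs (f (x + h) - f x - l * h) <= e * Rabs h.
Proof.
  intros H e He. destruct (H e He) as [d Hd]. exists d; split; [apply cond_pos|].
  intros h Hh. destruct (Req_dec h 0) as [->|Hn].
  - rewrite Rplus_0_r. replace (f x - f x - l * 0) with 0 by ring. rewrite Rabs_R0. lra.
  - specialize (Hd h Hn Hh).
    replace (f (x + h) - f x - l * h) with (((f (x + h) - f x) / h - l) * h) by (field; exact Hn).
    rewrite Rabs_mult. apply Rmult_le_compat_r; [apply Rabs_pos|lra].
Qed.

(** By [cexp_plus] the increment at [u] is [cexp u] times the increment at [0], so first-order
    expansions of [exp], [cos] and [sin] at [0] suffice. *)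
Lemma is_derive_cexp (u : C) : is_derive cexp u (cexp u).
Proof.
  apply is_derive_C_iff. intros e He.
  assert (Hp : 0 < exp (Re u)) by apply exp_pos.
  (* The real and imaginary parts of the remainder each cost at most [3 * e1 * Cmod h], which
     [8 * e1 * Cmod h] covers; the factor [exp (Re u)] is the modulus of [cexp u]. *)
  set (e1 := Rmin 1 (e / (8 * exp (Re u)))).
  assert (Hq : 0 < e / (8 * exp (Re u))) by (apply Rdiv_lt_0_compat; lra).
  assert (He1 : 0 < e1) by (apply Rmin_glb_lt; lra).
  assert (He2 : 8 * e1 * exp (Re u) <= e).
  { assert (H := Rmin_r 1 (e / (8 * exp (Re u)))). fold e1 in H.
    apply Rle_div_r in H; lra. }
  assert (He3 : e1 <= 1) by apply Rmin_l.
  destruct (derivable_pt_lim_le exp 0 _ (derivable_pt_lim_exp 0) e1 He1) as [d1 [Hd1 H1]].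
  destruct (derivable_pt_lim_le cos 0 _ (derivable_pt_lim_cos 0) e1 He1) as [d2 [Hd2 H2]].
  destruct (derivable_pt_lim_le sin 0 _ (derivable_pt_lim_sin 0) e1 He1) as [d3 [Hd3 H3]].
  exists (Rmin (Rmin d1 d2) (Rmin d3 (e1 / 2))).
  split; [repeat apply Rmin_glb_lt; lra|].
  intros y Hy.
  assert (G1 : Cmod (y - u) < d1) by (eapply Rlt_le_trans; [exact Hy|eapply Rle_trans; apply Rmin_l]).
  assert (G2 : Cmod (y - u) < d2) by (eapply Rlt_le_trans; [exact Hy|eapply Rle_trans; [apply Rmin_l|apply Rmin_r]]).
  assert (G3 : Cmod (y - u) < d3) by (eapply Rlt_le_trans; [exact Hy|eapply Rle_trans; [apply Rmin_r|apply Rmin_l]]).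
  assert (G4 : Cmod (y - u) < e1 / 2) by (eapply Rlt_le_trans; [exact Hy|eapply Rle_trans; [apply Rmin_r|apply Rmin_r]]).
  clear Hy.
  replace (cexp y - cexp u - cexp u * (y - u))%C with (cexp u * (cexp (y - u) - 1 - (y - u)))%C.
  2:{ replace (cexp y) with (cexp (u + (y - u))) by (f_equal; ring).
      rewrite cexp_plus. ring. }
  generalize dependent (y - u)%C. clear y. intros h G1 G2 G3 G4.
  assert (B : Cmod (cexp h - 1 - h) <= 8 * e1 * Cmod h).
  { assert (P := re_le_Cmod h). assert (Q := Rabs_Im_le h).
    assert (K0 := Cmod_ge_0 h).
    eapply Rle_trans; [apply Cmod_le_abs|].
    destruct h as [x y]. simpl in *.
    specialize (H1 x (Rle_lt_trans _ _ _ P G1)).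
    specialize (H2 y (Rle_lt_trans _ _ _ Q G2)).
    specialize (H3 y (Rle_lt_trans _ _ _ Q G3)).
    rewrite Rplus_0_l, exp_0 in H1. rewrite Rplus_0_l, cos_0, sin_0 in H2.
    rewrite Rplus_0_l, sin_0, cos_0 in H3.
    set (m := Cmod (x, y)) in *.
    assert (X1 : Rabs (exp x - 1) <= e1).
    { replace (exp x - 1) with ((exp x - 1 - 1 * x) + x) by ring.
      eapply Rle_trans; [apply Rabs_triang|]. nra. }
    assert (X2 : exp x <= 2). { apply Rabs_le_between in X1. lra. }
    assert (X3 : 0 < exp x) by apply exp_pos.
    assert (R1 : Rabs (exp x * cos y + - (1) + - x) <= e1 * m + 2 * (e1 * m)).
    { replace (exp x * cos y + - (1) + - x) with ((exp x - 1 - 1 * x) + exp x * (cos y - 1 - - 0 * y)) by ring.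
      eapply Rle_trans; [apply Rabs_triang|]. rewrite Rabs_mult, (Rabs_pos_eq (exp x)) by lra.
      assert (0 <= Rabs (cos y - 1 - -0 * y)) by apply Rabs_pos. nra. }
    assert (R2 : Rabs (exp x * sin y + - 0 + - y) <= e1 * (2 * m) + e1 * m).
    { replace (exp x * sin y + - 0 + - y) with ((exp x - 1) * sin y + (sin y - 0 - 1 * y)) by ring.
      eapply Rle_trans; [apply Rabs_triang|]. rewrite Rabs_mult.
      assert (S : Rabs (sin y) <= 2 * m).
      { replace (sin y) with ((sin y - 0 - 1 * y) + y) by ring.
        eapply Rle_trans; [apply Rabs_triang|]. nra. }
      assert (0 <= Rabs (sin y)) by apply Rabs_pos.
      assert (0 <= Rabs (exp x - 1)) by apply Rabs_pos. nra. }
    unfold Re, Im; simpl. nra. }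
  rewrite Cmod_mult, Cmod_cexp.
  assert (0 <= Cmod h) by apply Cmod_ge_0.
  apply Rle_trans with (exp (Re u) * (8 * e1 * Cmod h)); nra.
Qed.

(** * Goursat's theorem *)

Definition CInt (f : R -> C) (a b : R) : C := RInt (V := C_R_CompleteNormedModule) f a b.

Definition cont_on (f : R -> C) (a b : R) : Prop := forall t, a <= t <= b -> continuous f t.

Lemma cont_on_ex_RInt (f : R -> C) (a b : R) : a <= b -> cont_on f a b ->
  ex_RInt (V := C_R_CompleteNormedModule) f a b.
Proof.
  intros Hab H. apply (ex_RInt_continuous (V := C_R_CompleteNormedModule)).
  rewrite Rmin_left, Rmax_right by assumption. exact H.
Qed.

Lemma cont_on_sub (f : R -> C) (a b c d : R) : a <= c -> d <= b -> cont_on f a b -> cont_on f c d.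
Proof. intros Ha Hb H t Ht. apply H. lra. Qed.

Lemma CInt_Chasles (f : R -> C) (a b c : R) : a <= b <= c -> cont_on f a c ->
  CInt f a c = (CInt f a b + CInt f b c)%C.
Proof.
  intros Hb H. symmetry.
  apply (RInt_Chasles (V := C_R_CompleteNormedModule)); apply cont_on_ex_RInt; try lra;
    eapply cont_on_sub; try exact H; lra.
Qed.

Lemma CInt_minus (f g : R -> C) (a b : R) : a <= b -> cont_on f a b -> cont_on g a b ->
  CInt (fun t => f t - g t)%C a b = (CInt f a b - CInt g a b)%C.
Proof.
  intros Hab Hf Hg.
  apply (RInt_minus (V := C_R_CompleteNormedModule)); apply cont_on_ex_RInt; assumption.
Qed.

Lemma CInt_le (f : R -> C) (a b M : R) : a <= b -> cont_on f a b ->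
  (forall t, a <= t <= b -> Cmod (f t) <= M) -> Cmod (CInt f a b) <= (b - a) * M.
Proof.
  intros Hab Hf HM. rewrite Cmod_norm.
  apply (norm_RInt_le_const (V := C_R_NormedModule) f a b (CInt f a b) M Hab).
  - intros t Ht. specialize (HM t Ht). rewrite Cmod_norm in HM. exact HM.
  - apply (RInt_correct (V := C_R_CompleteNormedModule)). apply cont_on_ex_RInt; assumption.
Qed.

Lemma CInt_ext (f g : R -> C) (a b : R) : a <= b ->
  (forall t, a <= t <= b -> f t = g t) -> CInt f a b = CInt g a b.
Proof.
  intros Hab H. apply (RInt_ext (V := C_R_CompleteNormedModule)).
  rewrite Rmin_left, Rmax_right by assumption. intros t Ht. apply H. lra.
Qed.

Lemma is_RInt_affine (c0 c1 a b : R) :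
  is_RInt (fun t => c0 + c1 * t) a b (c0 * (b - a) + c1 * (b * b - a * a) / 2).
Proof.
  replace (c0 * (b - a) + c1 * (b * b - a * a) / 2)
    with (minus (c0 * b + c1 * (b * b) / 2) (c0 * a + c1 * (a * a) / 2))
    by (unfold minus, plus, opp; simpl; field).
  apply (is_RInt_derive (V:=R_CompleteNormedModule) (fun t => c0 * t + c1 * (t * t) / 2)).
  - intros t _. auto_derive; [trivial|field].
  - intros t _. apply continuity_pt_filterlim. reg.
Qed.

Lemma CInt_affine (p q : C) (a b : R) :
  CInt (fun t => p + q * RtoC t)%C a b = (p * (b - a) + q * (b * b - a * a) / 2)%C.
Proof.
  apply (is_RInt_unique (V := C_R_CompleteNormedModule)).
  destruct p as [p1 p2], q as [q1 q2].
  replace ((p1, p2) * (b - a) + (q1, q2) * (b * b - a * a) / 2)%C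
    with (p1 * (b - a) + q1 * (b * b - a * a) / 2, p2 * (b - a) + q2 * (b * b - a * a) / 2).
  2:{ unfold Cplus, Cmult, Cdiv, Cminus, Cinv, Copp, RtoC; simpl. f_equal; field. }
  apply (is_RInt_fct_extend_pair (U:=R_NormedModule) (V:=R_NormedModule)).
  - eapply is_RInt_ext; [|apply is_RInt_affine]. intros t _. simpl. ring.
  - eapply is_RInt_ext; [|apply is_RInt_affine]. intros t _. simpl. ring.
Qed.

(* The integral of [F z dz] along the positively oriented boundary of [x1,x2] x [y1,y2]. *)
Definition rect_int (F : C -> C) (x1 x2 y1 y2 : R) : C :=
  (CInt (fun x => F (x, y1)) x1 x2 - CInt (fun x => F (x, y2)) x1 x2
   + Ci * CInt (fun y => F (x2, y)) y1 y2 - Ci * CInt (fun y => F (x1, y)) y1 y2)%C.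

Definition cont_rect (F : C -> C) (x1 x2 y1 y2 : R) : Prop :=
  forall x y, x1 <= x <= x2 -> y1 <= y <= y2 -> continuous F (x, y).

Lemma cont_rect_sub (F : C -> C) (x1 x2 y1 y2 a1 a2 b1 b2 : R) :
  x1 <= a1 -> a2 <= x2 -> y1 <= b1 -> b2 <= y2 -> cont_rect F x1 x2 y1 y2 -> cont_rect F a1 a2 b1 b2.
Proof. intros ? ? ? ? H x y Hx Hy. apply H; lra. Qed.

Lemma cont_rect_h (F : C -> C) (x1 x2 y1 y2 y : R) : cont_rect F x1 x2 y1 y2 -> y1 <= y <= y2 ->
  cont_on (fun x => F (x, y)) x1 x2.
Proof.
  intros H Hy t Ht. apply continuous_R_C_iff. intros e He.
  destruct (proj1 (continuous_C_iff _ _) (H t y Ht Hy) e He) as [d [Hd H']].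
  exists d; split; [exact Hd|]. intros s Hs. apply H'.
  replace ((s, y) - (t, y))%C with (RtoC (s - t)).
  rewrite Cmod_R; exact Hs. unfold Cminus, Cplus, Copp, RtoC; simpl; f_equal; ring.
Qed.

Lemma cont_rect_v (F : C -> C) (x1 x2 y1 y2 x : R) : cont_rect F x1 x2 y1 y2 -> x1 <= x <= x2 ->
  cont_on (fun y => F (x, y)) y1 y2.
Proof.
  intros H Hx t Ht. apply continuous_R_C_iff. intros e He.
  destruct (proj1 (continuous_C_iff _ _) (H x t Hx Ht) e He) as [d [Hd H']].
  exists d; split; [exact Hd|]. intros s Hs. apply H'.
  replace ((x, s) - (x, t))%C with (Ci * RtoC (s - t))%C.
  rewrite Cmod_mult, Cmod_Ci, Cmod_R, Rmult_1_l; exact Hs.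
  unfold Cminus, Cplus, Copp, Cmult, Ci, RtoC; simpl; f_equal; ring.
Qed.

Lemma rect_int_split (F : C -> C) (x1 xm x2 y1 ym y2 : R) :
  x1 <= xm <= x2 -> y1 <= ym <= y2 -> cont_rect F x1 x2 y1 y2 ->
  rect_int F x1 x2 y1 y2 =
  (rect_int F x1 xm y1 ym + rect_int F xm x2 y1 ym
   + rect_int F x1 xm ym y2 + rect_int F xm x2 ym y2)%C.
Proof.
  intros Hx Hy H. unfold rect_int.
  rewrite (CInt_Chasles (fun x => F (x, y1)) x1 xm x2),
    (CInt_Chasles (fun x => F (x, y2)) x1 xm x2),
    (CInt_Chasles (fun y => F (x1, y)) y1 ym y2),
    (CInt_Chasles (fun y => F (x2, y)) y1 ym y2);
    try lra; try (eapply cont_rect_h; [exact H|lra]); try (eapply cont_rect_v; [exact H|lra]).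
  ring.
Qed.

(** The four sides are integrated explicitly. In Goursat's theorem this allows the first-order part
    of [F] at a point to be subtracted without changing the integral. *)
Lemma rect_int_affine (p q : C) (x1 x2 y1 y2 : R) :
  rect_int (fun z => p + q * z)%C x1 x2 y1 y2 = 0.
Proof.
  assert (Hh : forall y, (fun x => p + q * (x, y))%C = (fun x : R => (p + q * Ci * y) + q * RtoC x)%C).
  { intros y. apply FunctionalExtensionality.functional_extensionality. intros x.
    replace ((x, y) : C) with (RtoC x + Ci * RtoC y)%C.
    ring. unfold RtoC, Ci, Cmult, Cplus; simpl; f_equal; ring. }
  assert (Hv : forall x, (fun y => p + q * (x, y))%C = (fun y : R => (p + q * x) + q * Ci * RtoC y)%C).
  { intros x. apply FunctionalExtensionality.functional_extensionality. intros y.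
    replace ((x, y) : C) with (RtoC x + Ci * RtoC y)%C.
    ring. unfold RtoC, Ci, Cmult, Cplus; simpl; f_equal; ring. }
  unfold rect_int. rewrite !Hh, !Hv, !CInt_affine.
  field.
Qed.

Lemma rect_int_minus (F G : C -> C) (x1 x2 y1 y2 : R) : x1 <= x2 -> y1 <= y2 ->
  cont_rect F x1 x2 y1 y2 -> cont_rect G x1 x2 y1 y2 ->
  rect_int (fun z => F z - G z)%C x1 x2 y1 y2 = (rect_int F x1 x2 y1 y2 - rect_int G x1 x2 y1 y2)%C.
Proof.
  intros Hx Hy HF HG. unfold rect_int.
  rewrite !CInt_minus; try assumption;
   try (eapply cont_rect_h; [eassumption|lra]); try (eapply cont_rect_v; [eassumption|lra]).
  ring.
Qed.

Lemma rect_int_le (F : C -> C) (x1 x2 y1 y2 M : R) : x1 <= x2 -> y1 <= y2 ->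
  cont_rect F x1 x2 y1 y2 ->
  (forall x y, x1 <= x <= x2 -> y1 <= y <= y2 -> Cmod (F (x, y)) <= M) ->
  Cmod (rect_int F x1 x2 y1 y2) <= 2 * M * ((x2 - x1) + (y2 - y1)).
Proof.
  intros Hx Hy HF HM. unfold rect_int.
  assert (A1 : Cmod (CInt (fun x => F (x, y1)) x1 x2) <= (x2 - x1) * M).
  { apply CInt_le; [lra|eapply cont_rect_h; [eassumption|lra]|intros; apply HM; lra]. }
  assert (A2 : Cmod (CInt (fun x => F (x, y2)) x1 x2) <= (x2 - x1) * M).
  { apply CInt_le; [lra|eapply cont_rect_h; [eassumption|lra]|intros; apply HM; lra]. }
  assert (A3 : Cmod (CInt (fun y => F (x1, y)) y1 y2) <= (y2 - y1) * M).
  { apply CInt_le; [lra|eapply cont_rect_v; [eassumption|lra]|intros; apply HM; lra]. }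
  assert (A4 : Cmod (CInt (fun y => F (x2, y)) y1 y2) <= (y2 - y1) * M).
  { apply CInt_le; [lra|eapply cont_rect_v; [eassumption|lra]|intros; apply HM; lra]. }
  unfold Cminus.
  eapply Rle_trans; [apply Cmod_triangle|].
  eapply Rle_trans; [apply Rplus_le_compat_r, Cmod_triangle|].
  eapply Rle_trans; [apply Rplus_le_compat_r, Rplus_le_compat_r, Cmod_triangle|].
  rewrite !Cmod_opp, !Cmod_mult, Cmod_Ci. lra.
Qed.

(** * Bisection of rectangles and Goursat's theorem *)

Lemma pow_half_lt (w d : R) : 0 < d -> exists n, w * (1 / 2) ^ n < d.
Proof.
  intros Hd. destruct (Rle_dec w 0) as [Hw|Hw].
  - exists 0%nat. simpl. lra.
  - assert (Hq : 0 < d / w) by (apply Rdiv_lt_0_compat; lra).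
    destruct (pow_lt_1_zero (1 / 2) ltac:(rewrite Rabs_pos_eq; lra) (d / w) Hq) as [N HN].
    exists N. specialize (HN N (Nat.le_refl N)).
    rewrite Rabs_pos_eq in HN by (apply pow_le; lra).
    apply Rlt_div_r in HN; lra.
Qed.

Lemma nested_common_point (a b : nat -> R) :
  (forall n, a n <= a (S n)) -> (forall n, b (S n) <= b n) -> (forall n, a n <= b n) ->
  exists u, forall n, a n <= u <= b n.
Proof.
  intros Ha Hb Hab.
  assert (Ma : forall n k, a n <= a (n + k)%nat).
  { intros n k. induction k; [rewrite Nat.add_0_r; lra|].
    rewrite Nat.add_succ_r. specialize (Ha (n + k)%nat). lra. }
  assert (Mb : forall n k, b (n + k)%nat <= b n).
  { intros n k. induction k; [rewrite Nat.add_0_r; lra|].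
    rewrite Nat.add_succ_r. specialize (Hb (n + k)%nat). lra. }
  assert (Hc : forall n m, a n <= b m).
  { intros n m. apply Rle_trans with (1 := Ma n m).
    apply Rle_trans with (1 := Hab _). rewrite Nat.add_comm. apply Mb. }
  destruct (completeness (fun x => exists n, x = a n)) as [u [Hu1 Hu2]].
  - exists (b 0%nat). intros x [n ->]. apply Hc.
  - exists (a 0%nat). now exists 0%nat.
  - exists u. intros n. split.
    + apply Hu1. now exists n.
    + apply Hu2. intros x [m ->]. apply Hc.
Qed.

(** A Cousin-type induction principle. If [P] failed, it would fail on some quarter, then on a
    quarter of that, and so on; the nested rectangles shrink to a point [(u, v)], near which the
    local hypothesis makes [P] true. *)
Lemma rect_bisection (P : R -> R -> R -> R -> Prop) (x1 x2 y1 y2 : R) :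
  x1 <= x2 -> y1 <= y2 ->
  (forall a b c d, x1 <= a <= b -> b <= x2 -> y1 <= c <= d -> d <= y2 ->
     P a ((a + b) / 2) c ((c + d) / 2) -> P ((a + b) / 2) b c ((c + d) / 2) ->
     P a ((a + b) / 2) ((c + d) / 2) d -> P ((a + b) / 2) b ((c + d) / 2) d -> P a b c d) ->
  (forall u v, x1 <= u <= x2 -> y1 <= v <= y2 -> exists r, 0 < r /\
     forall a b c d, x1 <= a <= u -> u <= b <= x2 -> y1 <= c <= v -> v <= d <= y2 ->
       b - a < r -> d - c < r -> P a b c d) ->
  P x1 x2 y1 y2.
Proof.
  intros Hx Hy Hstep Hloc. apply Classical_Prop.NNPP. intros HN.
  set (good := fun s : (R * R) * (R * R) =>
    (x1 <= fst (fst s) <= snd (fst s) /\ snd (fst s) <= x2 /\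
     y1 <= fst (snd s) <= snd (snd s) /\ snd (snd s) <= y2 /\
     ~ P (fst (fst s)) (snd (fst s)) (fst (snd s)) (snd (snd s)))).
  set (half := fun s t : (R * R) * (R * R) =>
    fst (fst s) <= fst (fst t) /\ snd (fst t) <= snd (fst s) /\
    fst (snd s) <= fst (snd t) /\ snd (snd t) <= snd (snd s) /\
    snd (fst t) - fst (fst t) = (snd (fst s) - fst (fst s)) * (1 / 2) /\
    snd (snd t) - fst (snd t) = (snd (snd s) - fst (snd s)) * (1 / 2)).
  assert (Hex : forall s, good s -> exists t, good t /\ half s t).
  { intros [[a b] [c d]] (G1 & G2 & G3 & G4 & G5). simpl in *.
    apply Classical_Prop.NNPP. intros HN'. apply G5.
    apply Hstep; try lra; apply Classical_Prop.NNPP; intros Q; apply HN'.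
    - exists ((a, (a + b) / 2), (c, (c + d) / 2)). unfold good, half; simpl. repeat split; try lra. exact Q.
    - exists (((a + b) / 2, b), (c, (c + d) / 2)). unfold good, half; simpl. repeat split; try lra. exact Q.
    - exists ((a, (a + b) / 2), ((c + d) / 2, d)). unfold good, half; simpl. repeat split; try lra. exact Q.
    - exists (((a + b) / 2, b), ((c + d) / 2, d)). unfold good, half; simpl. repeat split; try lra. exact Q. }
  (* Keeping the proof of [good] in the state makes the choice of a bad quarter a function that can
     be iterated. *)
  set (next := fun s : {s | good s} =>
    let t := constructive_indefinite_description _ (Hex (proj1_sig s) (proj2_sig s)) in
    exist good (proj1_sig t) (proj1 (proj2_sig t))).
  assert (Hnext : forall s, half (proj1_sig s) (proj1_sig (next s))).
  { intros s. unfold next. simpl.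
    destruct (constructive_indefinite_description _ _) as [t [Ht1 Ht2]]. exact Ht2. }
  assert (G0 : good ((x1, x2), (y1, y2))) by (unfold good; simpl; repeat split; try lra; exact HN).
  set (S := fun n => proj1_sig (Nat.iter n next (exist good _ G0))).
  assert (HS : forall n, good (S n)) by (intros n; unfold S; apply proj2_sig).
  assert (HH : forall n, half (S n) (S (Datatypes.S n))) by (intros n; unfold S; simpl; apply Hnext).
  assert (Hw : forall n, snd (fst (S n)) - fst (fst (S n)) = (x2 - x1) * (1 / 2) ^ n).
  { induction n; [unfold S; simpl; ring|].
    destruct (HH n) as (_ & _ & _ & _ & E & _). rewrite E, IHn. simpl. ring. }
  assert (Hh : forall n, snd (snd (S n)) - fst (snd (S n)) = (y2 - y1) * (1 / 2) ^ n).
  { induction n; [unfold S; simpl; ring|].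
    destruct (HH n) as (_ & _ & _ & _ & _ & E). rewrite E, IHn. simpl. ring. }
  destruct (nested_common_point (fun n => fst (fst (S n))) (fun n => snd (fst (S n)))) as [u Hu].
  { intros n. apply HH. } { intros n. apply HH. } { intros n. apply HS. }
  destruct (nested_common_point (fun n => fst (snd (S n))) (fun n => snd (snd (S n)))) as [v Hv].
  { intros n. apply HH. } { intros n. apply HH. } { intros n. apply HS. }
  destruct (Hloc u v) as [r [Hr Hloc']].
  { destruct (HS 0%nat) as (K1 & K2 & _). specialize (Hu 0%nat). simpl in *. lra. }
  { destruct (HS 0%nat) as (_ & _ & K1 & K2 & _). specialize (Hv 0%nat). simpl in *. lra. }
  destruct (pow_half_lt ((x2 - x1) + (y2 - y1)) r Hr) as [n Hn].
  destruct (HS n) as (K1 & K2 & K3 & K4 & K5). apply K5.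
  specialize (Hw n). specialize (Hh n). specialize (Hu n). specialize (Hv n).
  simpl in Hu, Hv. assert (0 < (1/2)^n) by (apply pow_lt; lra).
  apply Hloc'; try lra; nra.
Qed.

Theorem goursat_rect (F : C -> C) (x1 x2 y1 y2 : R) : x1 <= x2 -> y1 <= y2 ->
  (forall x y, x1 <= x <= x2 -> y1 <= y <= y2 -> ex_derive F (x, y)) ->
  rect_int F x1 x2 y1 y2 = 0.
Proof.
  intros Hx Hy HD.
  assert (HF : cont_rect F x1 x2 y1 y2).
  { intros x y Qx Qy. apply ex_derive_C_continuous, HD; assumption. }
  assert (B : forall e, 0 < e -> Cmod (rect_int F x1 x2 y1 y2) <= e * (2 * ((x2 - x1) + (y2 - y1)) ^ 2)).
  { intros e He.
    (* The bound is quadratic in the side lengths, so the bounds of the four quarters add up to that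
       of the whole. Locally, [F] differs from its affine part by at most [e] times the half
       perimeter, and integrating over the perimeter gives exactly this bound. *)
    apply (rect_bisection (fun a b c d => Cmod (rect_int F a b c d) <= e * (2 * ((b - a) + (d - c)) ^ 2)));
      try assumption.
    - intros a b c d Ha Hb Hc Hd Q1 Q2 Q3 Q4.
      rewrite (rect_int_split F a ((a + b) / 2) b c ((c + d) / 2) d); try lra.
      2:{ eapply cont_rect_sub; [..|exact HF]; lra. }
      eapply Rle_trans; [apply Cmod_triangle|].
      eapply Rle_trans; [apply Rplus_le_compat_r, Cmod_triangle|].
      eapply Rle_trans; [apply Rplus_le_compat_r, Rplus_le_compat_r, Cmod_triangle|].
      nra.
    - intros u v Hu Hv. destruct (HD u v Hu Hv) as [l Hl].
      destruct (proj1 (is_derive_C_iff _ _ _) Hl e He) as [r [Hr Hr']].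
      exists (r / 2). split; [lra|]. intros a b c d Ha Hb Hc Hd Hba Hdc.
      set (A := fun z : C => ((F (u, v) - l * (u, v)) + l * z)%C).
      assert (HA : cont_rect A a b c d).
      { intros x y _ _. eapply is_derive_C_continuous. apply is_derive_C_affine. }
      assert (HF' : cont_rect F a b c d) by (eapply cont_rect_sub; [..|exact HF]; lra).
      replace (rect_int F a b c d) with (rect_int (fun z => F z - A z)%C a b c d).
      2:{ rewrite rect_int_minus; try lra; try assumption. unfold A. rewrite rect_int_affine. ring. }
      eapply Rle_trans; [apply (rect_int_le _ a b c d (e * ((b - a) + (d - c)))); try lra|].
      + intros x y Qx Qy. apply (continuous_minus (V:=C_NormedModule) F A); [apply HF'; lra|apply HA; lra].
      + intros x y Qx Qy.
        assert (Dz : Cmod ((x, y) - (u, v)) <= (b - a) + (d - c)).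
        { eapply Rle_trans; [apply Cmod_le_abs|]. simpl.
          assert (Rabs (x + - u) <= b - a) by (apply Rabs_le; lra).
          assert (Rabs (y + - v) <= d - c) by (apply Rabs_le; lra). lra. }
        unfold A.
        replace (F (x, y) - (F (u, v) - l * (u, v) + l * (x, y)))%C
          with (F (x, y) - F (u, v) - l * ((x, y) - (u, v)))%C by ring.
        eapply Rle_trans; [apply Hr'; lra|]. apply Rmult_le_compat_l; lra.
      + right. ring. }
  apply Cmod_eq_0, Rle_antisym; [|apply Cmod_ge_0].
  apply le_epsilon. intros e He.
  set (K := 2 * ((x2 - x1) + (y2 - y1)) ^ 2) in *.
  assert (HK : 0 <= K) by (unfold K; nra).
  eapply Rle_trans; [apply (B (e / (K + 1))); apply Rdiv_lt_0_compat; lra|].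
  rewrite Rplus_0_l. unfold Rdiv. rewrite Rmult_assoc.
  rewrite <- (Rmult_1_r e) at 2. apply Rmult_le_compat_l; [lra|].
  apply (Rmult_le_reg_l (K + 1)); [lra|]. rewrite <- Rmult_assoc, Rinv_r; lra.
Qed.

(** * Circle integrals *)

Lemma continuous_to_C_iff {U : UniformSpace} (f : U -> C) (x : U) :
  continuous f x <-> forall e, 0 < e -> locally x (fun y => Cmod (f y - f x) < e).
Proof.
  split.
  - intros H e He. apply (H (fun y => Cmod (y - f x) < e)). apply locally_C_iff.
    exists e; split; auto.
  - intros H P HP. apply locally_C_iff in HP. destruct HP as [e [He HP]].
    unfold filtermap. generalize (H e He). apply filter_imp. intros y. apply HP.
Qed.

Lemma continuous_Cminus {U : UniformSpace} (f g : U -> C) (x : U) :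
  continuous f x -> continuous g x -> continuous (fun y => f y - g y)%C x.
Proof. intros Hf Hg. exact (continuous_minus (V := C_NormedModule) f g x Hf Hg). Qed.

Lemma continuous_Cplus {U : UniformSpace} (f g : U -> C) (x : U) :
  continuous f x -> continuous g x -> continuous (fun y => f y + g y)%C x.
Proof. intros Hf Hg. exact (continuous_plus (V := C_NormedModule) f g x Hf Hg). Qed.

Lemma continuous_Cmult {U : UniformSpace} (f g : U -> C) (x : U) :
  continuous f x -> continuous g x -> continuous (fun y => f y * g y)%C x.
Proof.
  rewrite !continuous_to_C_iff. intros Hf Hg e He.
  set (K := Cmod (f x) + Cmod (g x) + 1).
  assert (Pf := Cmod_ge_0 (f x)). assert (Pg := Cmod_ge_0 (g x)).
  set (e' := Rmin 1 (e / K)).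
  assert (HK : 0 < K) by (unfold K; lra).
  assert (He' : 0 < e').
  { unfold e'. apply Rmin_glb_lt; [lra|]. apply Rdiv_lt_0_compat; assumption. }
  assert (He1 : e' <= 1) by apply Rmin_l.
  assert (He2 : e' * K <= e).
  { apply Rle_div_r; [exact HK|]. apply Rmin_r. }
  generalize (filter_and _ _ (Hf e' He') (Hg e' He')). apply filter_imp.
  intros y [H1 H2].
  replace (f y * g y - f x * g x)%C
    with ((f y - f x) * g x + (f x + (f y - f x)) * (g y - g x))%C by ring.
  eapply Rle_lt_trans; [apply Cmod_triangle|]. rewrite !Cmod_mult.
  assert (H3 := Cmod_triangle (f x) (f y - f x)).
  assert (H4 := Cmod_ge_0 (f y - f x)). assert (H5 := Cmod_ge_0 (g y - g x)).
  set (A := Cmod (f y - f x)) in *. set (B := Cmod (g y - g x)) in *.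
  set (D := Cmod (f x + (f y - f x))) in *.
  assert (A * Cmod (g x) <= e' * Cmod (g x)) by (apply Rmult_le_compat_r; lra).
  assert (D * B <= (Cmod (f x) + 1) * B) by (apply Rmult_le_compat_r; lra).
  assert ((Cmod (f x) + 1) * B < (Cmod (f x) + 1) * e') by (apply Rmult_lt_compat_l; lra).
  unfold K in *. lra.
Qed.

Lemma continuous_Cinv {U : UniformSpace} (f : U -> C) (x : U) : f x <> 0 ->
  continuous f x -> continuous (fun y => / f y)%C x.
Proof.
  intros Hx Hf. apply (continuous_comp f Cinv); [exact Hf|].
  eapply is_derive_C_continuous, is_derive_C_inv, Hx.
Qed.

(** Joint continuity at the points of [{c0} x [a, b]] and compactness of [[a, b]] make [k c]
    uniformly close to [k c0]. *)
Lemma CInt_param_continuous (k : C -> R -> C) (c0 : C) (a b r : R) : a <= b -> 0 < r ->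
  (forall c, Cmod (c - c0) < r -> cont_on (k c) a b) ->
  (forall t, a <= t <= b -> continuous (fun p : C * R => k (fst p) (snd p)) (c0, t)) ->
  continuous (fun c => CInt (k c) a b) c0.
Proof.
  intros Hab Hr Hk Hj. apply continuous_C_iff. intros e He.
  (* Passing through [k c0 t] at a nearby [t] bounds the integrand by [2 * e']; the [+ 1] keeps the
     denominator positive when [a = b]. *)
  set (e' := e / (4 * (b - a + 1))).
  assert (He' : 0 < e') by (apply Rdiv_lt_0_compat; lra).
  assert (Hloc : forall t, exists d : posreal, a <= t <= b -> forall c s,
     Cmod (c - c0) < d -> Rabs (s - t) < d -> Cmod (k c s - k c0 t) < e').
  { intros t. destruct (excluded_middle_informative (a <= t <= b)) as [Ht|Ht].
    2:{ exists (mkposreal 1 Rlt_0_1). tauto. }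
    destruct (proj1 (continuous_to_C_iff _ _) (Hj t Ht) e' He') as [d Hd].
    exists d. intros _ c s Hc Hs. apply (Hd (c, s)). split; [|exact Hs].
    split; [eapply Rle_lt_trans; [apply (re_le_Cmod (c - c0))|exact Hc]
           |eapply Rle_lt_trans; [apply (Rabs_Im_le (c - c0))|exact Hc]]. }
  set (delta := fun t => proj1_sig (constructive_indefinite_description _ (Hloc t))).
  assert (Hdelta : forall t, a <= t <= b -> forall c s,
     Cmod (c - c0) < delta t -> Rabs (s - t) < delta t -> Cmod (k c s - k c0 t) < e').
  { intros t. exact (proj2_sig (constructive_indefinite_description _ (Hloc t))). }
  destruct (compactness_value_1d a b delta) as [d Hd].
  exists (Rmin d r). split; [apply Rmin_glb_lt; [apply cond_pos|exact Hr]|].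
  intros c Hc.
  assert (Hc1 := Rlt_le_trans _ _ _ Hc (Rmin_l _ _)).
  assert (Hc2 := Rlt_le_trans _ _ _ Hc (Rmin_r _ _)).
  assert (Hc0 : cont_on (k c0) a b) by (apply Hk; rewrite Cmod_minus_0; exact Hr).
  rewrite <- CInt_minus by auto.
  apply Rle_lt_trans with ((b - a) * (2 * e')).
  - apply CInt_le; [exact Hab| |].
    + intros t Ht. apply continuous_Cminus; [apply Hk; assumption|apply Hc0; assumption].
    (* Compactness yields the centre [t] only under a double negation, hence the argument by
       contradiction. *)
    + intros s Hs. apply Rnot_lt_le. intros HN. apply (Hd s Hs). intros [t (Ht & Hst & Hdt)].
      assert (Q1 := Hdelta t Ht c s (Rlt_le_trans _ _ _ Hc1 Hdt) Hst).
      assert (Q2 : Cmod (k c0 s - k c0 t) < e').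
      { apply Hdelta; [exact Ht| |exact Hst]. rewrite Cmod_minus_0. apply cond_pos. }
      assert (Q3 := Cmod_triangle (k c s - k c0 t) (k c0 t - k c0 s)).
      replace (k c s - k c0 t + (k c0 t - k c0 s))%C with (k c s - k c0 s)%C in Q3 by ring.
      rewrite (Cmod_minus_sym (k c0 t)) in Q3. lra.
  - assert (E : e' * (4 * (b - a + 1)) = e) by (unfold e'; field; lra). nra.
Qed.

(** * Integrals over circles and their residues *)

Definition circ (r t : R) : C := (r * cos t, r * sin t).

Lemma circ_cexp (r t : R) : 0 < r -> circ r t = cexp (ln r, t).
Proof. intros Hr. unfold circ, cexp; simpl. rewrite exp_ln by exact Hr. reflexivity. Qed.

Lemma Cmod_circ (r t : R) : 0 < r -> Cmod (circ r t) = r.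
Proof. intros Hr. rewrite circ_cexp, Cmod_cexp by exact Hr. simpl. apply exp_ln, Hr. Qed.

Lemma circ_neq_0 (r t : R) : 0 < r -> circ r t <> 0.
Proof. intros Hr. apply Cmod_gt_0. rewrite Cmod_circ; exact Hr. Qed.

Lemma continuous_circ (r t : R) : continuous (circ r) t.
Proof.
  apply continuous_to_C_iff. intros e He.
  assert (H1 : continuous (fun t => r * cos t) t) by (apply continuity_pt_filterlim; reg).
  assert (H2 : continuous (fun t => r * sin t) t) by (apply continuity_pt_filterlim; reg).
  assert (He2 : 0 < e / 2) by lra.
  apply (filterlim_locally (F:=locally t)) with (eps := mkposreal _ He2) in H1.
  apply (filterlim_locally (F:=locally t)) with (eps := mkposreal _ He2) in H2.
  generalize (filter_and _ _ H1 H2). apply filter_imp. intros y [B1 B2].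
  change (Rabs (r * cos y - r * cos t) < e / 2) in B1.
  change (Rabs (r * sin y - r * sin t) < e / 2) in B2.
  eapply Rle_lt_trans; [apply Cmod_le_abs|]. simpl. unfold Rminus in *. lra.
Qed.

(* Under [u = ln (z - c)] circles become vertical segments, and the integrals over the two
   horizontal sides of a rectangle of height [2 PI] cancel by periodicity. *)
Lemma circle_residue (F : C -> C) (c L : C) (rho r : R) : 0 < r < rho ->
  (forall z, 0 < Cmod (z - c) < rho -> ex_derive F z) ->
  (forall e, 0 < e -> exists d, 0 < d /\
     forall z, 0 < Cmod (z - c) < d -> Cmod ((z - c) * F z - L) <= e) ->
  CInt (fun t => circ r t * F (c + circ r t))%C 0 (2 * PI) = (2 * PI * L)%C.
Proof.
  intros Hr HD HL.
  assert (HPI := PI_RGT_0).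
  set (G := fun u => (cexp u * F (c + cexp u))%C).
  assert (HcG : forall u, (c + cexp u - c)%C = cexp u) by (intros; ring).
  assert (HG : forall u : C, Re u <= ln r -> ex_derive G u).
  { intros u Hu. destruct (HD (c + cexp u)%C) as [l Hl].
    - rewrite HcG, Cmod_cexp. split; [apply exp_pos|].
      apply Rle_lt_trans with (exp (ln r)).
      + destruct Hu as [Hu| ->]; [left; apply exp_increasing; exact Hu|right; reflexivity].
      + rewrite exp_ln; lra.
    - eexists. apply is_derive_C_mult; [apply is_derive_cexp|].
      apply (is_derive_C_comp F (fun u => (c + cexp u)%C)); [exact Hl|].
      apply (is_derive_plus (K:=C_AbsRing) (V:=C_NormedModule)); [apply is_derive_const|apply is_derive_cexp]. }
  assert (Hcont : forall x, x <= ln r -> cont_on (fun y => G (x, y)) 0 (2 * PI)).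
  { intros x Hx. apply (cont_rect_v G x x 0 (2 * PI)); [|lra].
    intros x' y' Hx' _. apply ex_derive_C_continuous, HG. simpl. lra. }
  assert (Hx : forall x, x <= ln r ->
     CInt (fun y => G (x, y)) 0 (2 * PI) = CInt (fun y => G (ln r, y)) 0 (2 * PI)).
  { intros x Hx.
    assert (R0 : rect_int G x (ln r) 0 (2 * PI) = 0).
    { apply goursat_rect; try lra. intros x' y' Hx' _. apply HG. simpl. lra. }
    unfold rect_int in R0.
    replace (fun x0 => G (x0, 2 * PI)) with (fun x0 => G (x0, 0)) in R0.
    2:{ apply FunctionalExtensionality.functional_extensionality. intros x0. unfold G.
        replace (cexp (x0, 2 * PI)) with (cexp (x0, 0)); [reflexivity|].
        unfold cexp; simpl. rewrite cos_2PI, sin_2PI, cos_0, sin_0. reflexivity. }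
    assert (R1 : (Ci * (CInt (fun y => G (ln r, y)) 0 (2 * PI) - CInt (fun y => G (x, y)) 0 (2 * PI)))%C = 0).
    { rewrite <- R0. ring. }
    destruct (Ceq_dec (CInt (fun y => G (x, y)) 0 (2 * PI)) (CInt (fun y => G (ln r, y)) 0 (2 * PI))) as [E|E]; [exact E|].
    exfalso. revert R1. apply Cmult_neq_0; [exact Ci_nz|].
    apply Cminus_eq_contra. congruence. }
  replace (CInt (fun t => circ r t * F (c + circ r t))%C 0 (2 * PI))
    with (CInt (fun y => G (ln r, y)) 0 (2 * PI)).
  2:{ apply CInt_ext; [lra|]. intros t _. unfold G. rewrite <- circ_cexp; [reflexivity|lra]. }
  apply Ceq_minus, Cmod_eq_0, Rle_antisym; [|apply Cmod_ge_0].
  apply le_epsilon. intros e He. rewrite Rplus_0_l.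
  assert (He' : 0 < e / (2 * PI)) by (apply Rdiv_lt_0_compat; lra).
  destruct (HL _ He') as [d [Hd HLd]].
  (* The integral does not depend on the radius, so it may be taken over the circle of radius
     [exp x < d], where the integrand is within [e / (2 * PI)] of [L]. *)
  set (x := Rmin (ln r) (ln d - 1)).
  assert (Hx1 : x <= ln r) by apply Rmin_l.
  assert (Hx2 : x < ln d) by (assert (H := Rmin_r (ln r) (ln d - 1)); fold x in H; lra).
  rewrite <- (Hx x Hx1).
  (* The constant [L] is written as an affine function so that [CInt_affine] evaluates its
     integral. *)
  replace (2 * PI * L)%C with (CInt (fun t => L + 0 * RtoC t)%C 0 (2 * PI)).
  2:{ rewrite CInt_affine. rewrite !RtoC_mult. field. }
  assert (HcL : cont_on (fun t : R => L + 0 * RtoC t)%C 0 (2 * PI)).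
  { intros t _. apply (continuous_ext (fun _ => L)); [|apply continuous_const].
    intros s. change (L = L + 0 * RtoC s)%C. ring. }
  rewrite <- CInt_minus by (auto; lra).
  replace e with ((2 * PI - 0) * (e / (2 * PI))) by (field; lra).
  apply CInt_le; [lra| |].
  - intros t Ht. apply continuous_Cminus; [apply Hcont; assumption|apply HcL; exact Ht].
  - intros t Ht. replace (L + 0 * RtoC t)%C with L by ring. unfold G.
    rewrite <- (HcG (x, t)) at 1. apply HLd. rewrite HcG, Cmod_cexp. simpl.
    split; [apply exp_pos|]. rewrite <- (exp_ln d) by exact Hd. apply exp_increasing, Hx2.
Qed.

(** Cauchy's formula for the derivative. With [g c] subtracted, [(z - c)] times the integrand
    [(g z - g c) / (z - c)^2] is the difference quotient, so the residue condition is the definition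
    of [l]. *)
Lemma derivative_circle (g : C -> C) (c l : C) (rho r : R) : 0 < r < rho ->
  (forall z, Cmod (z - c) < rho -> ex_derive g z) -> is_derive g c l ->
  CInt (fun t => circ r t * ((g (c + circ r t) - g c) / (circ r t * circ r t)))%C 0 (2 * PI)
  = (2 * PI * l)%C.
Proof.
  intros Hr HD Hl.
  rewrite <- (circle_residue (fun z => (g z - g c) / ((z - c) * (z - c)))%C c l rho r Hr).
  - apply CInt_ext; [assert (H := PI_RGT_0); lra|]. intros t _.
    replace (c + circ r t - c)%C with (circ r t) by ring. reflexivity.
  - intros z Hz. destruct (HD z ltac:(lra)) as [lz Hlz].
    assert (Hz0 : (z - c)%C <> 0) by (apply Cmod_gt_0; lra).
    assert (Dz : is_derive (fun y : C => y - c)%C z (RtoC 1)).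
    { apply (is_derive_C_ext_loc (fun y : C => - c + 1 * y)%C _ _ _ 1); [lra|intros; ring|apply is_derive_C_affine]. }
    eapply (is_derive_C_div (fun z => g z - g c)%C (fun z => (z - c) * (z - c))%C).
    + apply Cmult_neq_0; exact Hz0.
    + apply is_derive_C_minus; [exact Hlz|apply is_derive_const].
    + apply is_derive_C_mult; exact Dz.
  - intros e He. destruct (proj1 (is_derive_C_iff _ _ _) Hl e He) as [d [Hd H]].
    exists d; split; [exact Hd|]. intros z Hz.
    assert (Hz0 : (z - c)%C <> 0) by (apply Cmod_gt_0; lra).
    replace ((z - c) * ((g z - g c) / ((z - c) * (z - c))) - l)%C
      with ((g z - g c - l * (z - c)) / (z - c))%C by (field; exact Hz0).
    rewrite Cmod_div by exact Hz0. apply Rle_div_l; [lra|]. apply H. lra.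
Qed.

(** Here [1 / (g z - g c)] has a simple pole at [c] with residue [1 / l]; injectivity at [c]
    excludes further poles. *)
Lemma inv_derivative_circle (g : C -> C) (c l : C) (rho r : R) : 0 < r < rho ->
  (forall z, Cmod (z - c) < rho -> ex_derive g z) ->
  (forall z, 0 < Cmod (z - c) < rho -> g z <> g c) -> is_derive g c l -> l <> 0 ->
  CInt (fun t => circ r t * / (g (c + circ r t) - g c))%C 0 (2 * PI) = (2 * PI * / l)%C.
Proof.
  intros Hr HD Hinj Hl Hl0.
  apply (circle_residue (fun z => / (g z - g c))%C c (/ l)%C rho r Hr).
  - intros z Hz. destruct (HD z ltac:(lra)) as [lz Hlz]. eexists.
    apply (is_derive_C_comp Cinv (fun z => g z - g c)%C).
    + apply is_derive_C_inv. apply Cminus_eq_contra, Hinj, Hz.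
    + apply is_derive_C_minus; [exact Hlz|apply is_derive_const].
  - intros e He. assert (Hm := proj1 (Cmod_gt_0 l) Hl0). set (m := Cmod l) in *.
    (* The first term gives [Cmod (g z - g c) >= m / 2 * Cmod (z - c)], which bounds the denominator
       from below; the second then makes the quotient at most [e]. *)
    set (e' := Rmin (m / 2) (e * (m * m) / 2)).
    assert (He' : 0 < e').
    { apply Rmin_glb_lt; [lra|]. assert (0 < m * m) by nra. assert (0 < e * (m * m)) by (apply Rmult_lt_0_compat; lra). lra. }
    destruct (proj1 (is_derive_C_iff _ _ _) Hl e' He') as [d [Hd H]].
    exists (Rmin d rho); split; [apply Rmin_glb_lt; lra|]. intros z Hz.
    assert (Hz1 : Cmod (z - c) < d) by (eapply Rlt_le_trans; [apply Hz|apply Rmin_l]).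
    assert (Hz2 : Cmod (z - c) < rho) by (eapply Rlt_le_trans; [apply Hz|apply Rmin_r]).
    specialize (H z Hz1).
    assert (Hg : (g z - g c)%C <> 0) by (apply Cminus_eq_contra, Hinj; lra).
    replace ((z - c) * / (g z - g c) - / l)%C
      with (- (g z - g c - l * (z - c)) / (l * (g z - g c)))%C by (field; split; assumption).
    rewrite Cmod_div by (apply Cmult_neq_0; assumption).
    rewrite Cmod_opp, Cmod_mult. fold m.
    set (q := Cmod (z - c)) in *.
    assert (K : m * q - e' * q <= Cmod (g z - g c)).
    { assert (K := Cmod_triangle_inv (l * (z - c)) (l * (z - c) - (g z - g c))).
      replace (l * (z - c) - (l * (z - c) - (g z - g c)))%C with (g z - g c)%C in K by ring.
      rewrite Cmod_mult in K. fold m q in K. rewrite (Cmod_minus_sym (l * (z - c))) in K. lra. }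
    assert (E1 : e' <= m / 2) by apply Rmin_l.
    assert (E2 : e' <= e * (m * m) / 2) by apply Rmin_r.
    assert (K2 : m / 2 * q <= Cmod (g z - g c)) by nra.
    assert (Hgp := proj1 (Cmod_gt_0 _) Hg).
    apply Rle_div_l; [apply Rmult_lt_0_compat; assumption|].
    eapply Rle_trans; [exact H|].
    apply Rle_trans with (e * (m * m) / 2 * q); [apply Rmult_le_compat_r; lra|].
    replace (e * (m * m) / 2 * q) with (e * (m * (m / 2 * q))) by field.
    apply Rmult_le_compat_l; [lra|]. apply Rmult_le_compat_l; lra.
Qed.

Lemma continuous_joint_slice (k : C -> R -> C) (c : C) (t : R) :
  continuous (fun p : C * R => k (fst p) (snd p)) (c, t) -> continuous (k c) t.
Proof.
  rewrite !continuous_to_C_iff. intros H e He. destruct (H e He) as [d Hd].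
  exists d. intros s Hs. apply (Hd (c, s)). split; [apply ball_center|exact Hs].
Qed.

(** [derivative_circle] writes [2 * PI * dg c] as an integral whose integrand is jointly continuous
    in [c] and [t]. The single radius [rho / 4] serves every [c] within [rho / 2] of [c0]. *)
Lemma derivative_continuous (g dg : C -> C) (c0 : C) (rho : R) : 0 < rho ->
  (forall z, Cmod (z - c0) < rho -> is_derive g z (dg z)) -> continuous dg c0.
Proof.
  intros Hrho HD. assert (HPI := PI_RGT_0). set (r := rho / 4).
  assert (Hr : 0 < r) by (unfold r; lra).
  assert (Htri : forall c w, Cmod (c - c0) < rho / 2 -> Cmod (w - c) < rho / 2 -> Cmod (w - c0) < rho).
  { intros c w H1 H2. replace (w - c0)%C with ((w - c) + (c - c0))%C by ring.
    eapply Rle_lt_trans; [apply Cmod_triangle|]. lra. }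
  set (k := fun (c : C) (t : R) =>
    (circ r t * ((g (c + circ r t) - g c) / (circ r t * circ r t)))%C).
  assert (Hk : forall c t, Cmod (c - c0) < rho / 2 ->
     continuous (fun p : C * R => k (fst p) (snd p)) (c, t)).
  { intros c t Hc. unfold k.
    assert (Q1 : continuous (fun p : C * R => fst p) (c, t)) by apply continuous_fst.
    assert (Q2 : continuous (fun p : C * R => circ r (snd p)) (c, t)).
    { apply (continuous_comp (fun p : C * R => snd p) (circ r)); [apply continuous_snd|apply continuous_circ]. }
    apply continuous_Cmult; [exact Q2|]. apply continuous_Cmult.
    - apply continuous_Cminus.
      + apply (continuous_comp (fun p : C * R => fst p + circ r (snd p))%C g).
        * apply continuous_Cplus; [exact Q1|exact Q2].
        * simpl. eapply is_derive_C_continuous, HD, (Htri c); [exact Hc|].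
          replace (c + circ r t - c)%C with (circ r t) by ring.
          rewrite Cmod_circ; [unfold r|]; lra.
      + apply (continuous_comp (fun p : C * R => fst p) g); [exact Q1|].
        eapply is_derive_C_continuous, HD. simpl. lra.
    - apply continuous_Cinv; [simpl; apply Cmult_neq_0; apply circ_neq_0; exact Hr|].
      apply continuous_Cmult; exact Q2. }
  assert (HK : forall c, Cmod (c - c0) < rho / 2 -> CInt (k c) 0 (2 * PI) = (2 * PI * dg c)%C).
  { intros c Hc. apply (derivative_circle g c (dg c) (rho / 2)).
    - unfold r; lra.
    - intros z Hz. exists (dg z). apply HD, (Htri c); assumption.
    - apply HD. lra. }
  assert (Hcont : continuous (fun c => CInt (k c) 0 (2 * PI)) c0).
  { apply (CInt_param_continuous k c0 0 (2 * PI) (rho / 2)); try lra.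
    - intros c Hc t _. apply continuous_joint_slice, Hk, Hc.
    - intros t _. apply Hk. rewrite Cmod_minus_0. lra. }
  assert (H2 : continuous (fun c => CInt (k c) 0 (2 * PI) * / (2 * PI))%C c0).
  { apply continuous_Cmult; [exact Hcont|apply continuous_const]. }
  assert (H2PI : (2 * PI)%C <> 0).
  { rewrite <- RtoC_mult. intros E. apply RtoC_inj in E. lra. }
  apply continuous_C_iff. intros e He.
  destruct (proj1 (continuous_C_iff _ _) H2 e He) as [d [Hd H3]].
  exists (Rmin d (rho / 2)). split; [apply Rmin_glb_lt; lra|]. intros y Hy.
  specialize (H3 y (Rlt_le_trans _ _ _ Hy (Rmin_l _ _))).
  rewrite !HK in H3.
  - replace (2 * PI * dg y * / (2 * PI))%C with (dg y) in H3 by (field; intros E; apply RtoC_inj in E; lra).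
    replace (2 * PI * dg c0 * / (2 * PI))%C with (dg c0) in H3 by (field; intros E; apply RtoC_inj in E; lra).
    exact H3.
  - rewrite Cmod_minus_0; lra.
  - eapply Rlt_le_trans; [exact Hy|apply Rmin_r].
Qed.

(** * Mean value inequality, strict differentiability, injective maps *)

Lemma is_derive_Re_line (g : C -> C) (z v l : C) (t : R) :
  is_derive g (z + RtoC t * v)%C l -> is_derive (fun s => Re (g (z + RtoC s * v)%C)) t (Re (l * v)).
Proof.
  intros H. apply is_derive_Reals. intros e He.
  assert (Hv := Cmod_ge_0 v).
  assert (He' : 0 < e / (2 * (Cmod v + 1))) by (apply Rdiv_lt_0_compat; lra).
  destruct (proj1 (is_derive_C_iff _ _ _) H _ He') as [d [Hd H']].
  assert (Hd' : 0 < d / (Cmod v + 1)) by (apply Rdiv_lt_0_compat; lra).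
  exists (mkposreal _ Hd'). intros h Hh0 Hh. simpl in Hh.
  apply Rlt_div_r in Hh; [|lra].
  assert (Ey : (z + RtoC (t + h) * v - (z + RtoC t * v))%C = (RtoC h * v)%C).
  { rewrite RtoC_plus. ring. }
  specialize (H' (z + RtoC (t + h) * v)%C). rewrite Ey, Cmod_mult, Cmod_R in H'.
  assert (Hh1 := Rabs_pos_lt h Hh0).
  assert (H1 : Rabs h * Cmod v < d) by nra. specialize (H' H1).
  replace ((Re (g (z + RtoC (t + h) * v)%C) - Re (g (z + RtoC t * v)%C)) / h - Re (l * v))
    with (Re (g (z + RtoC (t + h) * v) - g (z + RtoC t * v) - l * (RtoC h * v))%C / h).
  2:{ replace (l * (RtoC h * v))%C with (RtoC h * (l * v))%C by ring.
      unfold Cminus. rewrite !re_plus, !re_opp, re_scal_l. field. exact Hh0. }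
  unfold Rdiv. rewrite Rabs_mult, Rabs_inv. apply Rlt_div_l; [exact Hh1|].
  eapply Rle_lt_trans; [apply re_le_Cmod|]. eapply Rle_lt_trans; [exact H'|].
  assert (E : e / (2 * (Cmod v + 1)) * (2 * (Cmod v + 1)) = e) by (field; lra).
  set (q := e / (2 * (Cmod v + 1))) in *. nra.
Qed.

Lemma mean_value_Re (g dg : C -> C) (z w : C) (M : R) :
  (forall t, 0 <= t <= 1 -> is_derive g (z + RtoC t * (w - z))%C (dg (z + RtoC t * (w - z))%C) /\
     Cmod (dg (z + RtoC t * (w - z))%C) <= M) ->
  Rabs (Re (g w - g z)) <= M * Cmod (w - z).
Proof.
  intros H.
  destruct (MVT_gen (fun s => Re (g (z + RtoC s * (w - z))%C)) 0 1
     (fun t => Re (dg (z + RtoC t * (w - z)) * (w - z))%C)) as [t [Ht Et]].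
  - rewrite Rmin_left, Rmax_right by lra. intros t Ht. apply is_derive_Re_line, H. lra.
  - rewrite Rmin_left, Rmax_right by lra. intros t Ht.
    apply continuity_pt_filterlim. apply (ex_derive_continuous (V:=R_NormedModule)).
    eexists. apply is_derive_Re_line, H. lra.
  - rewrite Rmin_left, Rmax_right in Ht by lra.
    replace (z + 1 * (w - z))%C with w in Et by ring.
    replace (z + 0 * (w - z))%C with z in Et by ring.
    unfold Cminus at 1. rewrite re_plus, re_opp.
    replace (Re (g w) + - Re (g z)) with (Re (dg (z + t * (w - z)) * (w - z))%C) by lra.
    eapply Rle_trans; [apply re_le_Cmod|]. rewrite Cmod_mult.
    apply Rmult_le_compat_r; [apply Cmod_ge_0|]. apply H, Ht.
Qed.

(** The real mean value theorem is applied separately to the real part and to the imaginary part,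
    the latter as the real part of [- Ci * g]; this is the origin of the factor [2]. *)
Lemma mean_value (g dg : C -> C) (z w : C) (M : R) :
  (forall t, 0 <= t <= 1 -> is_derive g (z + RtoC t * (w - z))%C (dg (z + RtoC t * (w - z))%C) /\
     Cmod (dg (z + RtoC t * (w - z))%C) <= M) ->
  Cmod (g w - g z) <= 2 * M * Cmod (w - z).
Proof.
  intros H. eapply Rle_trans; [apply Cmod_le_abs|].
  assert (H1 := mean_value_Re g dg z w M H).
  assert (H2 : Rabs (Re (- Ci * g w - - Ci * g z)%C) <= M * Cmod (w - z)).
  { apply (mean_value_Re (fun u => - Ci * g u)%C (fun u => - Ci * dg u)%C).
    intros t Ht. destruct (H t Ht) as [D B]. split.
    - replace (- Ci * dg (z + t * (w - z)))%C
        with (0 * g (z + t * (w - z)) + - Ci * dg (z + t * (w - z)))%C by ring.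
      apply (is_derive_C_mult (fun _ => - Ci)%C g);
        [exact (is_derive_const (K:=C_AbsRing) (V:=C_NormedModule) (- Ci)%C _)|exact D].
    - rewrite Cmod_mult, Cmod_opp, Cmod_Ci. lra. }
  replace (Re (- Ci * g w - - Ci * g z)%C) with (Im (g w - g z)) in H2.
  2:{ destruct (g w), (g z). unfold Re, Im, Ci, Cminus, Cplus, Copp, Cmult; simpl. ring. }
  lra.
Qed.

Lemma Cmod_convex (c z w : C) (d t : R) : 0 <= t <= 1 ->
  Cmod (z - c) < d -> Cmod (w - c) < d -> Cmod (z + RtoC t * (w - z) - c) < d.
Proof.
  intros Ht Hz Hw.
  replace (z + RtoC t * (w - z) - c)%C with (RtoC (1 - t) * (z - c) + RtoC t * (w - c))%C
    by (rewrite RtoC_minus; ring).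
  eapply Rle_lt_trans; [apply Cmod_triangle|].
  rewrite !Cmod_mult, !Cmod_R, !Rabs_pos_eq by lra.
  destruct (Req_dec t 0) as [->|Hn]; [lra|].
  apply Rle_lt_trans with ((1 - t) * d + t * Cmod (w - c)).
  - apply Rplus_le_compat_r, Rmult_le_compat_l; lra.
  - assert (t * Cmod (w - c) < t * d) by (apply Rmult_lt_compat_l; lra). lra.
Qed.

(** The map [u => g u - dg c * u] has derivative [dg u - dg c], which is small near [c] because [dg]
    is continuous; the mean value inequality then applies with [e / 2]. *)
Lemma derivative_strict (g dg : C -> C) (c : C) (rho : R) : 0 < rho ->
  (forall z, Cmod (z - c) < rho -> is_derive g z (dg z)) ->
  forall e, 0 < e -> exists d, 0 < d <= rho /\
    forall z w, Cmod (z - c) < d -> Cmod (w - c) < d ->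
      Cmod (g w - g z - dg c * (w - z)) <= e * Cmod (w - z).
Proof.
  intros Hrho HD e He.
  assert (Hc := derivative_continuous g dg c rho Hrho HD).
  destruct (proj1 (continuous_C_iff _ _) Hc (e / 2) ltac:(lra)) as [d [Hd H]].
  exists (Rmin d rho). split; [split; [apply Rmin_glb_lt; lra|apply Rmin_r]|].
  intros z w Hz Hw.
  replace (g w - g z - dg c * (w - z))%C with ((g w - dg c * w) - (g z - dg c * z))%C by ring.
  replace (e * Cmod (w - z)) with (2 * (e / 2) * Cmod (w - z)) by field.
  apply (mean_value (fun u => g u - dg c * u)%C (fun u => dg u - dg c)%C).
  intros t Ht.
  assert (Hin := Cmod_convex c z w _ t Ht Hz Hw).
  set (u := (z + RtoC t * (w - z))%C) in *. split.
  - apply is_derive_C_minus.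
    + apply HD. eapply Rlt_le_trans; [exact Hin|apply Rmin_r].
    + apply (is_derive_C_ext_loc (fun y : C => 0 + dg c * y)%C _ _ _ 1); [lra|intros; ring|apply is_derive_C_affine].
  - left. apply H. eapply Rlt_le_trans; [exact Hin|apply Rmin_l].
Qed.

(* [dg c] times the circle integral around [c] of [1 / (g - g c)] is a nonzero constant at every
   [c] near [z0] with [dg c <> 0], and such [c] accumulate at [z0] since [g] is not locally
   constant; by continuity [dg z0] cannot vanish. *)
Lemma injective_derivative_neq_0 (g dg : C -> C) (z0 : C) (rho : R) : 0 < rho ->
  (forall z, Cmod (z - z0) < rho -> is_derive g z (dg z)) ->
  (forall z w, Cmod (z - z0) < rho -> Cmod (w - z0) < rho -> g z = g w -> z = w) ->
  dg z0 <> 0.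
Proof.
  intros Hrho HD Hinj H0. assert (HPI := PI_RGT_0).
  (* If [dg] vanished on a ball, [g] would be constant there and not injective. The other case
     produces points arbitrarily near [z0] where [dg] does not vanish. *)
  destruct (excluded_middle_informative
    (exists d, 0 < d <= rho /\ forall z, Cmod (z - z0) < d -> dg z = 0)) as [[d [Hd Hz]]|HN].
  - assert (Hw : Cmod (z0 + RtoC (d / 2) - z0) < d).
    { replace (z0 + RtoC (d / 2) - z0)%C with (RtoC (d / 2)) by ring.
      rewrite Cmod_R, Rabs_pos_eq; lra. }
    assert (Hz00 : Cmod (z0 - z0) < d) by (rewrite Cmod_minus_0; lra).
    assert (E : Cmod (g (z0 + RtoC (d / 2))%C - g z0) <= 2 * 0 * Cmod (z0 + RtoC (d / 2) - z0)).
    { apply (mean_value g dg). intros t Ht.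
      assert (Hin := Cmod_convex z0 z0 _ d t Ht Hz00 Hw). split.
      - apply HD. lra.
      - rewrite Hz by exact Hin. rewrite Cmod_0. lra. }
    assert (E0 : Cmod (g (z0 + RtoC (d / 2))%C - g z0) = 0).
    { apply Rle_antisym; [lra|apply Cmod_ge_0]. }
    apply Cmod_eq_0, Ceq_minus in E0.
    apply Hinj in E0; [|lra|rewrite Cmod_minus_0; lra].
    assert (E1 : RtoC (d / 2) = 0).
    { replace (RtoC (d / 2)) with (z0 + RtoC (d / 2) - z0)%C by ring. rewrite E0. ring. }
    apply RtoC_inj in E1. lra.
  - set (r := rho / 4). assert (Hr : 0 < r) by (unfold r; lra).
    assert (Htri : forall c w, Cmod (c - z0) < rho / 2 -> Cmod (w - c) < rho / 2 -> Cmod (w - z0) < rho).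
    { intros c w H1 H2. replace (w - z0)%C with ((w - c) + (c - z0))%C by ring.
      eapply Rle_lt_trans; [apply Cmod_triangle|]. lra. }
    set (k := fun (c : C) (t : R) => (circ r t * / (g (c + circ r t) - g c))%C).
    assert (Hk : forall c t, Cmod (c - z0) < rho / 2 ->
       continuous (fun p : C * R => k (fst p) (snd p)) (c, t)).
    { intros c t Hc. unfold k.
      assert (Q1 : continuous (fun p : C * R => fst p) (c, t)) by apply continuous_fst.
      assert (Q2 : continuous (fun p : C * R => circ r (snd p)) (c, t)).
      { apply (continuous_comp (fun p : C * R => snd p) (circ r)); [apply continuous_snd|apply continuous_circ]. }
      assert (Hw : Cmod (c + circ r t - z0) < rho).
      { apply (Htri c); [exact Hc|]. replace (c + circ r t - c)%C with (circ r t) by ring.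
        rewrite Cmod_circ; [unfold r|]; lra. }
      apply continuous_Cmult; [exact Q2|]. apply continuous_Cinv.
      - simpl. intros E. apply Ceq_minus, Hinj in E; [|exact Hw|lra].
        apply (circ_neq_0 r t Hr). replace (circ r t) with (c + circ r t - c)%C by ring.
        rewrite E. ring.
      - apply continuous_Cminus.
        + apply (continuous_comp (fun p : C * R => fst p + circ r (snd p))%C g).
          * apply continuous_Cplus; [exact Q1|exact Q2].
          * simpl. eapply is_derive_C_continuous, HD, Hw.
        + apply (continuous_comp (fun p : C * R => fst p) g); [exact Q1|].
          eapply is_derive_C_continuous, HD. simpl. lra. }
    assert (HK : forall c, Cmod (c - z0) < rho / 2 -> dg c <> 0 ->
       CInt (k c) 0 (2 * PI) = (2 * PI * / dg c)%C).
    { intros c Hc Hnz. apply (inv_derivative_circle g c (dg c) (rho / 2)).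
      - unfold r; lra.
      - intros z Hz. exists (dg z). apply HD, (Htri c); assumption.
      - intros z Hz E. apply Hinj in E.
        + subst z. rewrite Cmod_minus_0 in Hz. lra.
        + apply (Htri c); lra.
        + lra.
      - apply HD. lra.
      - exact Hnz. }
    assert (Hcont : continuous (fun c => dg c * CInt (k c) 0 (2 * PI))%C z0).
    { apply continuous_Cmult; [apply (derivative_continuous g dg z0 rho Hrho HD)|].
      apply (CInt_param_continuous k z0 0 (2 * PI) (rho / 2)); try lra.
      - intros c Hc t _. apply continuous_joint_slice, Hk, Hc.
      - intros t _. apply Hk. rewrite Cmod_minus_0. lra. }
    (* The product is [0] at [z0] by [H0] and [2 * PI] wherever [dg c <> 0]. A tolerance of [PI]
       keeps the two values apart, so [dg] vanishes near [z0], against [HN]. *)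
    destruct (proj1 (continuous_C_iff _ _) Hcont PI HPI) as [d [Hd H]].
    apply HN. exists (Rmin d (rho / 2)). split.
    + split; [apply Rmin_glb_lt; lra|]. eapply Rle_trans; [apply Rmin_r|lra].
    + intros z Hz. apply Classical_Prop.NNPP. intros Hnz.
      specialize (H z (Rlt_le_trans _ _ _ Hz (Rmin_l _ _))).
      rewrite HK in H; [|eapply Rlt_le_trans; [exact Hz|apply Rmin_r]|exact Hnz].
      rewrite H0 in H.
      replace (dg z * (2 * PI * / dg z) - 0 * CInt (k z0) 0 (2 * PI))%C with (RtoC (2 * PI)) in H.
      * rewrite Cmod_R, Rabs_pos_eq in H; lra.
      * rewrite RtoC_mult. field. exact Hnz.
Qed.

(** * Local inverses *)

(** The steps from index [n] on add up to at most [2 * s * (1 / 2) ^ n], so intervals of that radius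
    around the coordinates of [z n] are nested; the two coordinates together give the factor [4]. *)
Lemma geometric_limit (z : nat -> C) (s : R) :
  (forall n, Cmod (z (S n) - z n) <= s * (1 / 2) ^ n) ->
  exists l : C, forall n, Cmod (l - z n) <= 4 * s * (1 / 2) ^ n.
Proof.
  intros H.
  assert (Hs : 0 <= s).
  { specialize (H 0%nat). simpl in H. assert (K := Cmod_ge_0 (z 1%nat - z 0%nat)). lra. }
  assert (Hp : forall n, 0 < (1 / 2) ^ n) by (intros n; apply pow_lt; lra).
  assert (HR : forall n, Rabs (Re (z (S n)) - Re (z n)) <= s * (1 / 2) ^ n).
  { intros n. eapply Rle_trans; [|apply H]. eapply Rle_trans; [|apply re_le_Cmod].
    right. reflexivity. }
  assert (HI : forall n, Rabs (Im (z (S n)) - Im (z n)) <= s * (1 / 2) ^ n).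
  { intros n. eapply Rle_trans; [|apply H]. eapply Rle_trans; [|apply Rabs_Im_le].
    right. reflexivity. }
  destruct (nested_common_point (fun n => Re (z n) - 2 * s * (1 / 2) ^ n)
    (fun n => Re (z n) + 2 * s * (1 / 2) ^ n)) as [u Hu].
  { intros n. specialize (HR n). apply Rabs_le_between in HR. simpl. lra. }
  { intros n. specialize (HR n). apply Rabs_le_between in HR. simpl. lra. }
  { intros n. specialize (Hp n). nra. }
  destruct (nested_common_point (fun n => Im (z n) - 2 * s * (1 / 2) ^ n)
    (fun n => Im (z n) + 2 * s * (1 / 2) ^ n)) as [v Hv].
  { intros n. specialize (HI n). apply Rabs_le_between in HI. simpl. lra. }
  { intros n. specialize (HI n). apply Rabs_le_between in HI. simpl. lra. }
  { intros n. specialize (Hp n). nra. }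
  exists (u, v). intros n. eapply Rle_trans; [apply Cmod_le_abs|].
  unfold Cminus. rewrite re_plus, re_opp, im_plus, im_opp.
  specialize (Hu n). specialize (Hv n). simpl in Hu, Hv.
  change (Re (u, v)) with u. change (Im (u, v)) with v.
  assert (Rabs (u + - Re (z n)) <= 2 * s * (1 / 2) ^ n) by (apply Rabs_le; lra).
  assert (Rabs (v + - Im (z n)) <= 2 * s * (1 / 2) ^ n) by (apply Rabs_le; lra).
  lra.
Qed.

(** Strict differentiability with error [Cmod (dg a) / 2] makes [g] expanding near [a]. It also
    makes the simplified Newton map [T z = z - (g z - y) / dg a] a contraction of ratio [1 / 2],
    whose fixed points solve [g z = y]. *)
Lemma local_inverse (g dg : C -> C) (a : C) (rho : R) : 0 < rho ->
  (forall z, Cmod (z - a) < rho -> is_derive g z (dg z)) -> dg a <> 0 ->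
  exists d m eta, 0 < d <= rho /\ 0 < m /\ 0 < eta /\
    (forall z w, Cmod (z - a) < d -> Cmod (w - a) < d -> m * Cmod (w - z) <= Cmod (g w - g z)) /\
    (forall y, Cmod (y - g a) < eta -> exists z, Cmod (z - a) < d /\ g z = y).
Proof.
  intros Hrho HD Hl. set (l := dg a) in *. assert (Hm := proj1 (Cmod_gt_0 l) Hl).
  set (m := Cmod l) in *.
  destruct (derivative_strict g dg a rho Hrho HD (m / 2) ltac:(lra)) as [d [Hd H]]. fold l in H.
  (* The first Newton step has length [s = Cmod (y - g a) / m] and the limit lies within [4 * s] of
     [a]; [eta = m * d / 4] gives [4 * s < d]. *)
  exists d, (m / 2), (m * d / 4). repeat split; try lra.
  - nra.
  - intros z w Hz Hw. specialize (H z w Hz Hw).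
    assert (K := Cmod_triangle_inv (l * (w - z)) (l * (w - z) - (g w - g z))).
    replace (l * (w - z) - (l * (w - z) - (g w - g z)))%C with (g w - g z)%C in K by ring.
    rewrite Cmod_mult in K. fold m in K. rewrite (Cmod_minus_sym (l * (w - z))) in K. lra.
  - intros y Hy. set (T := fun z => (z - (g z - y) / l)%C).
    assert (HT : forall z w, Cmod (z - a) < d -> Cmod (w - a) < d ->
       Cmod (T w - T z) <= / 2 * Cmod (w - z)).
    { intros z w Hz Hw. specialize (H z w Hz Hw). unfold T.
      replace (w - (g w - y) / l - (z - (g z - y) / l))%C
        with (- (g w - g z - l * (w - z)) / l)%C by (field; exact Hl).
      rewrite Cmod_div, Cmod_opp by exact Hl. fold m. apply Rle_div_l; lra. }
    set (s := Cmod (T a - a)).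
    assert (Hs : 4 * s < d).
    { unfold s, T. replace (a - (g a - y) / l - a)%C with ((y - g a) / l)%C by (field; exact Hl).
      rewrite Cmod_div by exact Hl. fold m.
      assert (Cmod (y - g a) / m < d / 4); [|lra]. apply Rlt_div_l; lra. }
    assert (Hs0 : 0 <= s) by apply Cmod_ge_0.
    set (z := fun n => Nat.iter n T a).
    assert (Hp : forall n, 0 < (1 / 2) ^ n) by (intros n; apply pow_lt; lra).
    assert (Hz : forall n, Cmod (z n - a) <= 2 * s * (1 - (1 / 2) ^ n) /\
        Cmod (z (S n) - a) <= 2 * s * (1 - (1 / 2) ^ S n) /\
        Cmod (z (S n) - z n) <= s * (1 / 2) ^ n).
    { induction n as [|n (I1 & I2 & I3)].
      - change (z 1%nat) with (T a). change (z 0%nat) with a.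
        rewrite Cmod_minus_0, pow_O, pow_1. fold s. repeat split; lra.
      - assert (B : forall k, 2 * s * (1 - (1 / 2) ^ k) < d).
        { intros k. specialize (Hp k). nra. }
        assert (I4 : Cmod (z (S (S n)) - z (S n)) <= s * (1 / 2) ^ S n).
        { change (z (S (S n))) with (T (z (S n))). change (z (S n)) with (T (z n)) at 2.
          eapply Rle_trans; [apply HT; eapply Rle_lt_trans; eauto|].
          rewrite <- (tech_pow_Rmult _ n). lra. }
        split; [exact I2|]. split; [|exact I4].
        replace (z (S (S n)) - a)%C with ((z (S (S n)) - z (S n)) + (z (S n) - a))%C by ring.
        eapply Rle_trans; [apply Cmod_triangle|].
        rewrite <- (tech_pow_Rmult _ (S n)). lra. }
    destruct (geometric_limit z s) as [x Hx]; [intros n; apply Hz|].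
    assert (Hxa : Cmod (x - a) < d).
    { specialize (Hx 0%nat). rewrite pow_O in Hx. change (z 0%nat) with a in Hx. lra. }
    exists x. split; [exact Hxa|].
    assert (HTx : Cmod (T x - x) = 0).
    { apply Rle_antisym; [|apply Cmod_ge_0]. apply le_epsilon. intros e He. rewrite Rplus_0_l.
      destruct (pow_half_lt (8 * s) e He) as [n Hn].
      replace (T x - x)%C with ((T x - z (S n)) + - (x - z (S n)))%C by ring.
      eapply Rle_trans; [apply Cmod_triangle|]. rewrite Cmod_opp.
      assert (Q1 := Hx (S n)). assert (Q2 := Hx n).
      assert (Q3 : Cmod (T x - z (S n)) <= / 2 * Cmod (x - z n)).
      { change (z (S n)) with (T (z n)). apply HT; [|exact Hxa].
        destruct (Hz n) as [Q _]. specialize (Hp n). nra. }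
      rewrite <- (tech_pow_Rmult _ n) in Q1. lra. }
    apply Cmod_eq_0 in HTx. unfold T in HTx.
    replace (g x) with (y + (g x - y) / l * l)%C by (field; exact Hl).
    replace ((g x - y) / l)%C with (- (x - (g x - y) / l - x))%C by ring.
    rewrite HTx. ring.
Qed.

Lemma local_inverse_injective (g : C -> C) (a : C) (d m : R) : 0 < m ->
  (forall z w, Cmod (z - a) < d -> Cmod (w - a) < d -> m * Cmod (w - z) <= Cmod (g w - g z)) ->
  forall z w, Cmod (z - a) < d -> Cmod (w - a) < d -> g z = g w -> z = w.
Proof.
  intros Hm H z w Hz Hw E. specialize (H z w Hz Hw). rewrite E, Cmod_minus_0 in H.
  assert (K := Cmod_ge_0 (w - z)). symmetry. apply Ceq_minus, Cmod_eq_0. nra.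
Qed.

(** Write [h] and [k] for the increments of [F] and [f]. Continuity of [F] makes [h] small, so
    differentiability of [g] gives [k = l * h + o(h)]; since [l <> 0] this forces [h = O(y - z)],
    and dividing by [l] yields the derivative. *)
Lemma is_derive_lift (g f F : C -> C) (z l lf : C) (r : R) : 0 < r ->
  (forall y, Cmod (y - z) < r -> g (F y) = f y) -> continuous F z ->
  is_derive f z lf -> is_derive g (F z) l -> l <> 0 -> is_derive F z (lf / l)%C.
Proof.
  intros Hr HgF HF Hf Hg Hl. assert (Hm := proj1 (Cmod_gt_0 l) Hl). set (m := Cmod l) in *.
  apply is_derive_C_iff. intros e He.
  set (N := Cmod lf). assert (HN : 0 <= N) by apply Cmod_ge_0.
  set (e2 := Rmin 1 (e * m / 2)).
  assert (He2 : 0 < e2) by (apply Rmin_glb_lt; nra).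
  assert (He2a : e2 <= 1) by apply Rmin_l. assert (He2b : e2 <= e * m / 2) by apply Rmin_r.
  (* The first term yields [m / 2 * Cmod h <= (N + 1) * Cmod q]. The second turns [e1 * Cmod h] into
     half of [e * m * Cmod q]; [e2] supplies the other half. *)
  set (e1 := Rmin (m / 2) (e * (m * m) / (4 * (N + 1)))).
  assert (He1 : 0 < e1).
  { apply Rmin_glb_lt; [lra|]. apply Rdiv_lt_0_compat; [|lra].
    apply Rmult_lt_0_compat; nra. }
  assert (He1a : e1 <= m / 2) by apply Rmin_l.
  assert (He1b : e1 * (4 * (N + 1)) <= e * (m * m)).
  { apply Rle_div_r; [lra|apply Rmin_r]. }
  destruct (proj1 (is_derive_C_iff _ _ _) Hf e2 He2) as [d2 [Hd2 H2]].
  destruct (proj1 (is_derive_C_iff _ _ _) Hg e1 He1) as [d1 [Hd1 H1]].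
  destruct (proj1 (continuous_C_iff _ _) HF d1 Hd1) as [d3 [Hd3 H3]].
  exists (Rmin r (Rmin d2 d3)). split; [repeat apply Rmin_glb_lt; lra|].
  intros y Hy.
  assert (Y1 : Cmod (y - z) < r) by (eapply Rlt_le_trans; [exact Hy|apply Rmin_l]).
  assert (Y2 : Cmod (y - z) < d2) by (eapply Rlt_le_trans; [exact Hy|eapply Rle_trans; [apply Rmin_r|apply Rmin_l]]).
  assert (Y3 : Cmod (y - z) < d3) by (eapply Rlt_le_trans; [exact Hy|eapply Rle_trans; [apply Rmin_r|apply Rmin_r]]).
  specialize (H2 y Y2). specialize (H1 (F y) (H3 y Y3)).
  rewrite !HgF in H1 by (rewrite ?Cmod_minus_0; assumption).
  set (k := (f y - f z)%C) in *. set (h := (F y - F z)%C) in *. set (q := (y - z)%C) in *.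
  assert (K1 : m * Cmod h - e1 * Cmod h <= Cmod k).
  { assert (K := Cmod_triangle_inv (l * h) (l * h - k)).
    replace (l * h - (l * h - k))%C with k in K by ring.
    rewrite Cmod_mult, (Cmod_minus_sym (l * h)) in K. fold m in K. lra. }
  assert (K2 : Cmod k <= N * Cmod q + e2 * Cmod q).
  { replace k with (lf * q + (k - lf * q))%C by ring.
    eapply Rle_trans; [apply Cmod_triangle|]. rewrite Cmod_mult. fold N. lra. }
  assert (Q := Cmod_ge_0 q). assert (Hh := Cmod_ge_0 h).
  assert (K3 : m / 2 * Cmod h <= (N + 1) * Cmod q) by nra.
  replace (h - lf / l * q)%C with ((- (k - l * h) + (k - lf * q)) / l)%C by (field; exact Hl).
  rewrite Cmod_div by exact Hl. fold m. apply Rle_div_l; [exact Hm|].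
  eapply Rle_trans; [apply Cmod_triangle|]. rewrite Cmod_opp.
  assert (K4 : e1 * Cmod h <= e * m / 2 * Cmod q).
  { apply (Rmult_le_reg_l (m / 2)); [lra|].
    replace (m / 2 * (e1 * Cmod h)) with (e1 * (m / 2 * Cmod h)) by ring.
    apply Rle_trans with (e1 * ((N + 1) * Cmod q)); [apply Rmult_le_compat_l; lra|].
    replace (e1 * ((N + 1) * Cmod q)) with (e1 * (4 * (N + 1)) / 4 * Cmod q) by field.
    replace (m / 2 * (e * m / 2 * Cmod q)) with (e * (m * m) / 4 * Cmod q) by field.
    apply Rmult_le_compat_r; lra. }
  assert (K5 : e2 * Cmod q <= e * m / 2 * Cmod q) by (apply Rmult_le_compat_r; lra).
  lra.
Qed.

(** * Lifting maps of the disc *)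

(** Connectedness of [[0, 1]] for a locally constant predicate. Let [T] be the supremum of the
    initial segments on which [P] holds: [P] holds just below [T], hence around [T]. *)
Lemma locally_constant_interval (P : R -> Prop) : P 0 ->
  (forall t, 0 <= t <= 1 -> exists d, 0 < d /\
     ((forall s, 0 <= s <= 1 -> Rabs (s - t) < d -> P s) \/
      (forall s, 0 <= s <= 1 -> Rabs (s - t) < d -> ~ P s))) ->
  P 1.
Proof.
  intros H0 Hloc.
  set (E := fun x => 0 <= x <= 1 /\ forall s, 0 <= s <= x -> P s).
  destruct (completeness E) as [T [HT1 HT2]].
  { exists 1. intros x [Hx _]. lra. }
  { exists 0. split; [lra|]. intros s Hs. replace s with 0 by lra. exact H0. }
  assert (T0 : 0 <= T).
  { apply HT1. split; [lra|]. intros s Hs. replace s with 0 by lra. exact H0. }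
  assert (T1 : T <= 1) by (apply HT2; intros x [Hx _]; lra).
  destruct (Hloc T (conj T0 T1)) as [d [Hd Hcase]].
  assert (Hx : exists x, E x /\ T - d < x).
  { apply Classical_Prop.NNPP. intros HN. assert (T <= T - d); [|lra].
    apply HT2. intros x Hx. apply Rnot_lt_le. intros Hlt. apply HN. now exists x. }
  destruct Hx as [x [[Hx1 Hx2] Hx3]].
  assert (HxT : x <= T) by (apply HT1; split; assumption).
  assert (HPd : forall s, 0 <= s <= 1 -> Rabs (s - T) < d -> P s).
  { destruct Hcase as [Hc|Hc]; [exact Hc|]. exfalso.
    apply (Hc x); [lra|apply Rabs_def1; lra|apply Hx2; lra]. }
  (* Since [x'] again belongs to [E], it is at most [T], which leaves only [x' = 1]. *)
  set (x' := Rmin 1 (T + d / 2)).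
  assert (A1 : x' <= 1) by apply Rmin_l. assert (A2 : x' <= T + d / 2) by apply Rmin_r.
  assert (HE : E x').
  { split; [split; [apply Rmin_glb; lra|exact A1]|].
    intros s Hs. destruct (Rle_dec s x) as [Hsx|Hsx]; [apply Hx2; lra|].
    apply HPd; [lra|apply Rabs_def1; lra]. }
  assert (HT' := HT1 _ HE).
  destruct HE as [_ HE]. apply HE. split; [lra|].
  unfold x' in *. apply Rmin_case_strong; intros; [lra|]. rewrite Rmin_right in HT' by lra. lra.
Qed.

Definition locally_injective_at (g : C -> C) (e : C) : Prop :=
  exists r, 0 < r /\ forall z w, Cmod (z - e) < r -> Cmod (w - e) < r -> g z = g w -> z = w.

Definition convex (W : C -> Prop) : Prop :=
  forall z w t, W z -> W w -> 0 <= t <= 1 -> W (z + RtoC t * (w - z))%C.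

Lemma convex_ball (c : C) (d : R) : convex (fun z => Cmod (z - c) < d).
Proof. intros z w t Hz Hw Ht. apply Cmod_convex; assumption. Qed.

Lemma convex_and (V W : C -> Prop) : convex V -> convex W -> convex (fun z => V z /\ W z).
Proof. intros HV HW z w t [? ?] [? ?] Ht. split; [apply HV|apply HW]; assumption. Qed.

Lemma continuous_on_segment (F : C -> C) (p q : C) (t e : R) :
  continuous F (p + RtoC t * (q - p))%C -> 0 < e ->
  exists d, 0 < d /\ forall s, Rabs (s - t) < d ->
    Cmod (F (p + RtoC s * (q - p))%C - F (p + RtoC t * (q - p))%C) < e.
Proof.
  intros H He. destruct (proj1 (continuous_C_iff _ _) H e He) as [d [Hd H']].
  assert (Hq := Cmod_ge_0 (q - p)).
  exists (d / (Cmod (q - p) + 1)). split; [apply Rdiv_lt_0_compat; lra|].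
  intros s Hs. apply H'.
  replace (p + s * (q - p) - (p + t * (q - p)))%C with (RtoC (s - t) * (q - p))%C
    by (rewrite RtoC_minus; ring).
  rewrite Cmod_mult, Cmod_R. apply Rlt_div_r in Hs; [|lra].
  assert (K := Rabs_pos (s - t)). nra.
Qed.

(** Along the segment from [p] to [q], agreement is an open condition by local injectivity of [g],
    and disagreement is open by continuity. *)
Lemma lift_unique (g F1 F2 : C -> C) (W : C -> Prop) (p q : C) : convex W ->
  (forall z, W z -> continuous F1 z /\ continuous F2 z /\ g (F1 z) = g (F2 z) /\
     locally_injective_at g (F1 z)) ->
  W p -> W q -> F1 p = F2 p -> F1 q = F2 q.
Proof.
  intros HW H Hp Hq Ep.
  set (c := fun t : R => (p + RtoC t * (q - p))%C).
  replace q with (c 1) by (unfold c; ring).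
  apply (locally_constant_interval (fun t => F1 (c t) = F2 (c t))).
  { replace (c 0) with p by (unfold c; ring). exact Ep. }
  intros t Ht.
  destruct (H (c t) (HW p q t Hp Hq Ht)) as (C1 & C2 & _ & [r [Hr Hinj]]).
  destruct (Ceq_dec (F1 (c t)) (F2 (c t))) as [E|E].
  - destruct (continuous_on_segment F1 p q t r C1 Hr) as [d1 [Hd1 D1]].
    destruct (continuous_on_segment F2 p q t r C2 Hr) as [d2 [Hd2 D2]].
    exists (Rmin d1 d2). split; [apply Rmin_glb_lt; lra|]. left. intros s Hs Hst.
    apply Hinj.
    + apply D1. eapply Rlt_le_trans; [exact Hst|apply Rmin_l].
    + rewrite E. apply D2. eapply Rlt_le_trans; [exact Hst|apply Rmin_r].
    + apply H. apply HW; assumption.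
  - set (e := Cmod (F1 (c t) - F2 (c t))).
    assert (He : 0 < e) by (apply Cmod_gt_0, Cminus_eq_contra, E).
    destruct (continuous_on_segment F1 p q t (e / 2) C1 ltac:(lra)) as [d1 [Hd1 D1]].
    destruct (continuous_on_segment F2 p q t (e / 2) C2 ltac:(lra)) as [d2 [Hd2 D2]].
    exists (Rmin d1 d2). split; [apply Rmin_glb_lt; lra|]. right. intros s Hs Hst Es.
    specialize (D1 s (Rlt_le_trans _ _ _ Hst (Rmin_l _ _))).
    specialize (D2 s (Rlt_le_trans _ _ _ Hst (Rmin_r _ _))).
    fold (c s) (c t) in D1, D2.
    assert (K : e <= Cmod (F1 (c t) - F1 (c s)) + Cmod (F2 (c s) - F2 (c t))).
    { unfold e. replace (F1 (c t) - F2 (c t))%C with ((F1 (c t) - F1 (c s)) + (F2 (c s) - F2 (c t)))%C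
        by (rewrite Es; ring). apply Cmod_triangle. }
    rewrite Cmod_minus_sym in D1. lra.
Qed.

Lemma convex_disc (r : R) : convex (fun z => Cmod z < r).
Proof.
  assert (E : forall x : C, Cmod (x - 0) = Cmod x) by (intros x; f_equal; ring).
  intros z w t Hz Hw Ht. rewrite <- E. apply Cmod_convex; [exact Ht| |]; rewrite E; assumption.
Qed.

(** Strict convexity of the disc, by the parallelogram law. *)
Lemma Cmod_midpoint_lt (x y : C) (r : R) : Cmod x = r -> Cmod y = r -> x <> y ->
  Cmod ((x + y) / 2) < r.
Proof.
  intros Hx Hy Hn.
  assert (H2 : Cmod 2 = 2) by (rewrite Cmod_R, Rabs_pos_eq; lra).
  rewrite Cmod_div, H2 by (intros E; apply RtoC_inj in E; lra).
  assert (P : Cmod (x + y) ^ 2 + Cmod (x - y) ^ 2 = 2 * Cmod x ^ 2 + 2 * Cmod y ^ 2).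
  { rewrite !Cmod2_alt. destruct x, y; unfold Re, Im; simpl. ring. }
  rewrite Hx, Hy in P.
  assert (K : 0 < Cmod (x - y)) by (apply Cmod_gt_0, Cminus_eq_contra, Hn).
  assert (K1 := Cmod_ge_0 (x + y)). assert (K2 := Cmod_ge_0 x).
  apply Rlt_div_l; [lra|]. nra.
Qed.

(** * Continuation of a lift from a small disc to the unit disc *)

Section DiscLifting.

Variables (g f : C -> C) (Y : C -> Prop) (a : C).

Definition is_lift_at (F : C -> C) (z : C) : Prop :=
  Y (F z) /\ g (F z) = f z /\ continuous F z.

Definition is_disc_lift (r : R) (F : C -> C) : Prop :=
  F 0 = a /\ forall z, Cmod z < r -> is_lift_at F z.

(* Local solvability of the lifting problem over the ball of radius [d] around [zeta]. *)
Definition evenly_covered (zeta : C) (d : R) : Prop :=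
  forall p e, Cmod (p - zeta) < d -> Y e -> g e = f p ->
    exists tau : C -> C, tau p = e /\ forall z, Cmod (z - zeta) < d -> is_lift_at tau z.

Hypothesis g_locally_injective : forall e, Y e -> locally_injective_at g e.

(** The centre is excluded because [f 0] will be the point [b], over which [g] is not assumed to be
    a covering; a lift near [0] is supplied separately to [disc_lift_exists]. *)
Hypothesis f_evenly_covered :
  forall zeta, 0 < Cmod zeta < 1 -> exists d, 0 < d /\ evenly_covered zeta d.

Lemma is_lift_at_ext (F G : C -> C) (z : C) (d : R) : 0 < d ->
  (forall y, Cmod (y - z) < d -> F y = G y) -> is_lift_at F z -> is_lift_at G z.
Proof.
  intros Hd E (H1 & H2 & H3). rewrite (E z) in H1, H2 by (rewrite Cmod_minus_0; exact Hd).
  split; [exact H1|split; [exact H2|]]. apply continuous_C_iff. intros e He.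
  destruct (proj1 (continuous_C_iff _ _) H3 e He) as [d' [Hd' H]].
  exists (Rmin d d'). split; [apply Rmin_glb_lt; lra|]. intros y Hy.
  rewrite <- !E.
  - apply H. eapply Rlt_le_trans; [exact Hy|apply Rmin_r].
  - rewrite Cmod_minus_0; exact Hd.
  - eapply Rlt_le_trans; [exact Hy|apply Rmin_l].
Qed.

Lemma is_lift_unique (F1 F2 : C -> C) (W : C -> Prop) (p q : C) : convex W ->
  (forall z, W z -> is_lift_at F1 z) -> (forall z, W z -> is_lift_at F2 z) ->
  W p -> W q -> F1 p = F2 p -> F1 q = F2 q.
Proof.
  intros HW H1 H2. apply (lift_unique g F1 F2 W p q HW). intros z Hz.
  destruct (H1 z Hz) as (A1 & A2 & A3). destruct (H2 z Hz) as (B1 & B2 & B3).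
  repeat split; try assumption.
  - congruence.
  - apply g_locally_injective, A1.
Qed.

(** All lifts take the value [a] at [0], so any two agree on the smaller disc. At [z] the union uses
    the lift on the disc of radius [(Cmod z + R0) / 2], which also describes it near [z]. *)
Lemma disc_lift_union (R0 : R) : 0 < R0 ->
  (forall r, 0 < r < R0 -> exists F, is_disc_lift r F) -> exists F, is_disc_lift R0 F.
Proof.
  intros HR H.
  assert (H' : forall r, exists F, 0 < r < R0 -> is_disc_lift r F).
  { intros r. destruct (excluded_middle_informative (0 < r < R0)) as [Hr|Hr].
    - destruct (H r Hr) as [F HF]. now exists F.
    - exists (fun _ => RtoC 0). tauto. }
  set (L := fun r => proj1_sig (constructive_indefinite_description _ (H' r))).
  assert (HL : forall r, 0 < r < R0 -> is_disc_lift r (L r)).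
  { intros r. exact (proj2_sig (constructive_indefinite_description _ (H' r))). }
  assert (Hagree : forall r s z, 0 < r < R0 -> 0 < s < R0 -> Cmod z < r -> Cmod z < s -> L r z = L s z).
  { intros r s z Hr Hs Zr Zs. destruct (HL r Hr) as [E1 L1]. destruct (HL s Hs) as [E2 L2].
    apply (is_lift_unique (L r) (L s) (fun z => Cmod z < Rmin r s) 0 z).
    - apply convex_disc.
    - intros y Hy. apply L1. eapply Rlt_le_trans; [exact Hy|apply Rmin_l].
    - intros y Hy. apply L2. eapply Rlt_le_trans; [exact Hy|apply Rmin_r].
    - rewrite Cmod_0. apply Rmin_glb_lt; lra.
    - apply Rmin_glb_lt; assumption.
    - congruence. }
  assert (Hz0 : forall z : C, 0 <= Cmod z) by apply Cmod_ge_0.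
  exists (fun z => L ((Cmod z + R0) / 2) z). split.
  - rewrite Cmod_0. apply HL. lra.
  - intros z Hz. set (r := (Cmod z + R0) / 2).
    assert (Hr : 0 < r < R0) by (specialize (Hz0 z); unfold r; lra).
    assert (Hzr : Cmod z < r) by (unfold r; lra).
    apply (is_lift_at_ext (L r) _ z (r - Cmod z)); [lra| |apply HL; assumption].
    intros y Hy. assert (K := Cmod_triangle_inv y z). specialize (Hz0 y).
    apply Hagree; lra.
Qed.

(** A Lebesgue number for the circle, obtained from compactness of the square [[-1, 1]^2]. Points
    off the circle get a radius so small compared with their distance to it that none can be the
    centre attached to a point of the circle. *)
Lemma evenly_covered_circle (R0 : R) : 0 < R0 < 1 ->
  exists d, 0 < d /\ forall zeta, Cmod zeta = R0 -> evenly_covered zeta d.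
Proof.
  intros HR.
  (* Coordinates within [delta] give a distance below [2 * delta]; adding a ball of radius
     [d <= delta] stays below [4 * delta]. *)
  assert (Hloc : forall zeta : C, exists d : posreal,
    (Cmod zeta <> R0 -> 2 * d <= Rabs (Cmod zeta - R0)) /\
    (Cmod zeta = R0 -> evenly_covered zeta (4 * d))).
  { intros zeta. destruct (Req_dec (Cmod zeta) R0) as [E|E].
    - destruct (f_evenly_covered zeta) as [d [Hd H]]; [lra|].
      assert (Hd4 : 0 < d / 4) by lra.
      exists (mkposreal _ Hd4). split; [tauto|]. intros _. simpl.
      replace (4 * (d / 4)) with d by field. exact H.
    - assert (Hp : 0 < Rabs (Cmod zeta - R0) / 2) by (assert (K := Rabs_pos_lt (Cmod zeta - R0)); lra).
      exists (mkposreal _ Hp). split; [intros _; simpl; lra|tauto]. }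
  set (delta := fun x y : R => proj1_sig (constructive_indefinite_description _ (Hloc (x, y)))).
  assert (Hdelta : forall x y, (Cmod (x, y) <> R0 -> 2 * delta x y <= Rabs (Cmod (x, y) - R0)) /\
    (Cmod (x, y) = R0 -> evenly_covered (x, y) (4 * delta x y))).
  { intros x y. exact (proj2_sig (constructive_indefinite_description _ (Hloc (x, y)))). }
  destruct (compactness_value_2d (-1) 1 (-1) 1 delta) as [d Hd].
  exists d. split; [apply cond_pos|]. intros [x y] Hz.
  apply Classical_Prop.NNPP. intros HN.
  assert (Bx := re_le_Cmod (x, y)). assert (By := Rabs_Im_le (x, y)). simpl in Bx, By.
  apply (Hd x y).
  { apply Rabs_le_between. lra. } { apply Rabs_le_between. lra. }
  intros (u & v & _ & _ & Hu & Hv & Hduv). apply HN.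
  assert (Hclose : Cmod ((x, y) - (u, v)) < 2 * delta u v).
  { eapply Rle_lt_trans; [apply Cmod_le_abs|]. simpl. unfold Rminus in Hu, Hv. lra. }
  destruct (Hdelta u v) as [D1 D2].
  destruct (Req_dec (Cmod (u, v)) R0) as [E|E].
  - specialize (D2 E).
    assert (Hsub : forall w : C, Cmod (w - (x, y)) < d -> Cmod (w - (u, v)) < 4 * delta u v).
    { intros w Hw. replace (w - (u, v))%C with ((w - (x, y)) + ((x, y) - (u, v)))%C by ring.
      eapply Rle_lt_trans; [apply Cmod_triangle|]. assert (K := cond_pos (delta u v)). lra. }
    intros p e Hp He Hge. destruct (D2 p e (Hsub p Hp) He Hge) as [tau [T1 T2]].
    exists tau. split; [exact T1|]. intros z Hzz. apply T2, Hsub, Hzz.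
  - exfalso. specialize (D1 E).
    assert (K1 := Cmod_triangle_inv (x, y) (u, v)).
    assert (K2 := Cmod_triangle_inv (u, v) (x, y)). rewrite (Cmod_minus_sym (u, v)) in K2.
    rewrite Hz in K1, K2. assert (Rabs (Cmod (u, v) - R0) < 2 * delta u v); [|lra].
    apply Rabs_def1; lra.
Qed.

(* Past the circle of radius [R0] the lift is continued along each radius by the local lift
   around the point where the radius meets the circle. Two such local lifts agree on the overlap
   of their balls: the midpoint of the two centres lies in the disc, where both equal [F]. *)
Lemma disc_lift_extend (R0 : R) (F : C -> C) : 0 < R0 < 1 -> is_disc_lift R0 F ->
  exists R1 G, R0 < R1 /\ is_disc_lift R1 G.
Proof.
  intros HR [F0 HF].
  destruct (evenly_covered_circle R0 HR) as [d' [Hd' Hcov']].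
  (* The bound [d <= R0] makes the scaling factor of [p] nonnegative. The point [p zeta] lies on the
     radius of [zeta], at distance [d / 2] inside the circle, and is where the local lift is matched
     with [F]. *)
  set (d := Rmin d' R0). assert (Hd : 0 < d) by (apply Rmin_glb_lt; lra).
  assert (HdR : d <= R0) by apply Rmin_r. assert (Hdd : d <= d') by apply Rmin_l.
  set (p := fun zeta : C => (RtoC (1 - d / (2 * R0)) * zeta)%C).
  assert (Hq : d / (2 * R0) * R0 = d / 2) by (field; lra).
  assert (Hq1 : 0 <= 1 - d / (2 * R0)).
  { apply (Rmult_le_reg_r R0); lra. }
  assert (Hq0 : 0 < d / (2 * R0)) by (apply Rdiv_lt_0_compat; lra).
  assert (Hp1 : forall zeta, Cmod zeta = R0 -> Cmod (p zeta) < R0).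
  { intros zeta E. unfold p. rewrite Cmod_mult, Cmod_R, E, Rabs_pos_eq by lra. lra. }
  assert (Hp2 : forall zeta, Cmod zeta = R0 -> Cmod (p zeta - zeta) < d).
  { intros zeta E. unfold p.
    replace (RtoC (1 - d / (2 * R0)) * zeta - zeta)%C with (RtoC (- (d / (2 * R0))) * zeta)%C
      by (rewrite RtoC_minus, RtoC_opp; ring).
    rewrite Cmod_mult, Cmod_R, E, Rabs_Ropp, Rabs_pos_eq by lra. lra. }
  assert (Hex : forall zeta, exists tau, Cmod zeta = R0 -> tau (p zeta) = F (p zeta) /\
     forall z, Cmod (z - zeta) < d -> is_lift_at tau z).
  { intros zeta. destruct (Req_dec (Cmod zeta) R0) as [E|E].
    2:{ exists F. tauto. }
    destruct (HF _ (Hp1 _ E)) as (A1 & A2 & _).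
    destruct (Hcov' zeta E (p zeta) (F (p zeta))) as [tau [T1 T2]]; try assumption.
    { specialize (Hp2 _ E). lra. }
    exists tau. intros _. split; [exact T1|]. intros z Hz. apply T2. lra. }
  set (tau := fun zeta => proj1_sig (constructive_indefinite_description _ (Hex zeta))).
  assert (Htau : forall zeta, Cmod zeta = R0 -> tau zeta (p zeta) = F (p zeta) /\
     forall z, Cmod (z - zeta) < d -> is_lift_at (tau zeta) z).
  { intros zeta. exact (proj2_sig (constructive_indefinite_description _ (Hex zeta))). }
  assert (AgF : forall zeta z, Cmod zeta = R0 -> Cmod (z - zeta) < d -> Cmod z < R0 ->
     tau zeta z = F z).
  { intros zeta z E Hz HzR. destruct (Htau zeta E) as [T1 T2].
    apply (is_lift_unique (tau zeta) F (fun z => Cmod (z - zeta) < d /\ Cmod z < R0) (p zeta) z).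
    - apply convex_and; [apply convex_ball|apply convex_disc].
    - intros y [Hy _]. apply T2, Hy.
    - intros y [_ Hy]. apply HF, Hy.
    - split; [apply Hp2|apply Hp1]; exact E.
    - split; assumption.
    - exact T1. }
  assert (Ag : forall zeta xi z, Cmod zeta = R0 -> Cmod xi = R0 ->
     Cmod (z - zeta) < d -> Cmod (z - xi) < d -> tau zeta z = tau xi z).
  { intros zeta xi z E1 E2 H1 H2. destruct (Ceq_dec zeta xi) as [->|Hne]; [reflexivity|].
    set (m := ((zeta + xi) / 2)%C).
    assert (Hm : Cmod m < R0) by (apply Cmod_midpoint_lt; assumption).
    assert (H22 : Cmod 2 = 2) by (rewrite Cmod_R, Rabs_pos_eq; lra).
    assert (H20 : RtoC 2 <> 0) by (intros Q; apply RtoC_inj in Q; lra).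
    assert (Hzx : Cmod (xi - zeta) < 2 * d).
    { replace (xi - zeta)%C with ((z - zeta) - (z - xi))%C by ring.
      unfold Cminus at 1. eapply Rle_lt_trans; [apply Cmod_triangle|]. rewrite Cmod_opp. lra. }
    assert (Hm1 : Cmod (m - zeta) < d).
    { unfold m. replace ((zeta + xi) / 2 - zeta)%C with ((xi - zeta) / 2)%C by (field; exact H20).
      rewrite Cmod_div, H22 by exact H20. lra. }
    assert (Hm2 : Cmod (m - xi) < d).
    { unfold m. replace ((zeta + xi) / 2 - xi)%C with (- (xi - zeta) / 2)%C by (field; exact H20).
      rewrite Cmod_div, Cmod_opp, H22 by exact H20. lra. }
    apply (is_lift_unique (tau zeta) (tau xi) (fun z => Cmod (z - zeta) < d /\ Cmod (z - xi) < d) m z).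
    - apply convex_and; apply convex_ball.
    - intros y [Hy _]. apply Htau; assumption.
    - intros y [_ Hy]. apply Htau; assumption.
    - split; assumption.
    - split; assumption.
    - rewrite !AgF by assumption. reflexivity. }
  (* Radial projection onto the circle: it selects the local lift used at [z]. Its own continuity
     never enters, because local lifts with different centres agree wherever both are defined. *)
  set (rad := fun z : C => (RtoC (R0 / Cmod z) * z)%C).
  assert (Hrad1 : forall z, R0 <= Cmod z -> Cmod (rad z) = R0).
  { intros z Hz. unfold rad. rewrite Cmod_mult, Cmod_R, Rabs_pos_eq.
    - field. lra.
    - left. apply Rdiv_lt_0_compat; lra. }
  assert (Hrad2 : forall z, R0 <= Cmod z < R0 + d -> Cmod (z - rad z) < d).
  { intros z Hz. unfold rad.
    replace (z - RtoC (R0 / Cmod z) * z)%C with (RtoC (1 - R0 / Cmod z) * z)%C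
      by (rewrite RtoC_minus; ring).
    assert (R0 / Cmod z <= 1) by (apply Rle_div_l; lra).
    rewrite Cmod_mult, Cmod_R, Rabs_pos_eq by lra.
    replace ((1 - R0 / Cmod z) * Cmod z) with (Cmod z - R0) by (field; lra). lra. }
  set (G := fun z => if Rlt_dec (Cmod z) R0 then F z else tau (rad z) z).
  exists (R0 + d), G. split; [lra|]. split.
  - unfold G. destruct (Rlt_dec (Cmod 0) R0) as [_|HN]; [exact F0|].
    exfalso. apply HN. rewrite Cmod_0. lra.
  - intros z Hz. destruct (Rlt_dec (Cmod z) R0) as [Hin|Hout].
    + apply (is_lift_at_ext F _ z (R0 - Cmod z)); [lra| |apply HF, Hin].
      intros y Hy. assert (K := Cmod_triangle_inv y z). unfold G.
      destruct (Rlt_dec (Cmod y) R0) as [_|HN]; [reflexivity|lra].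
    + apply Rnot_lt_le in Hout.
      assert (E := Hrad1 z Hout). assert (D := Hrad2 z (conj Hout Hz)).
      set (r := Rmin (R0 + d - Cmod z) (d - Cmod (z - rad z))).
      apply (is_lift_at_ext (tau (rad z)) _ z r).
      * apply Rmin_glb_lt; lra.
      * intros y Hy.
        assert (Hy1 := Rlt_le_trans _ _ _ Hy (Rmin_l _ _)).
        assert (Hy2 := Rlt_le_trans _ _ _ Hy (Rmin_r _ _)).
        assert (K := Cmod_triangle_inv y z).
        assert (Hyr : Cmod (y - rad z) < d).
        { replace (y - rad z)%C with ((y - z) + (z - rad z))%C by ring.
          eapply Rle_lt_trans; [apply Cmod_triangle|]. lra. }
        unfold G. destruct (Rlt_dec (Cmod y) R0) as [Hy0|Hy0].
        -- apply AgF; assumption.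
        -- apply Rnot_lt_le in Hy0. apply Ag; try assumption.
           ++ apply Hrad1, Hy0.
           ++ apply Hrad2. lra.
      * apply Htau; assumption.
Qed.

(** Let [T] be the supremum of the radii up to [1] that admit a lift. Uniting the smaller lifts
    reaches [T] itself, and the extension past a circle rules out [T < 1]. *)
Lemma disc_lift_exists (r0 : R) : 0 < r0 -> (exists F, is_disc_lift r0 F) ->
  exists F, is_disc_lift 1 F.
Proof.
  intros Hr0 HF0.
  set (P := fun r => 0 < r <= 1 /\ exists F, is_disc_lift r F).
  assert (Hmono : forall r s F, s <= r -> is_disc_lift r F -> is_disc_lift s F).
  { intros r s F Hs [E H]. split; [exact E|]. intros z Hz. apply H. lra. }
  assert (HP0 : P (Rmin 1 r0)).
  { split; [split; [apply Rmin_glb_lt; lra|apply Rmin_l]|].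
    destruct HF0 as [F HF]. exists F. eapply Hmono; [apply Rmin_r|exact HF]. }
  destruct (completeness P) as [T [HT1 HT2]].
  { exists 1. intros x [Hx _]. lra. }
  { exists (Rmin 1 r0). exact HP0. }
  assert (HT0 : 0 < T) by (specialize (HT1 _ HP0); destruct HP0 as [Q _]; lra).
  assert (HTle : T <= 1) by (apply HT2; intros x [Hx _]; lra).
  assert (HTl : exists F, is_disc_lift T F).
  { apply disc_lift_union; [exact HT0|]. intros r Hr.
    assert (Hx : exists x, P x /\ r < x).
    { apply Classical_Prop.NNPP. intros HN. assert (T <= r); [|lra].
      apply HT2. intros x Hx. apply Rnot_lt_le. intros Hlt. apply HN. now exists x. }
    destruct Hx as [x [[Hx [F HF]] Hrx]]. exists F. eapply Hmono; [|exact HF]. lra. }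
  destruct (Rle_lt_or_eq_dec T 1 HTle) as [Hlt| ->]; [exfalso|exact HTl].
  destruct HTl as [F HF].
  destruct (disc_lift_extend T F (conj HT0 Hlt) HF) as (R1 & G & HR1 & HG).
  assert (HP1 : P (Rmin 1 R1)).
  { split; [split; [apply Rmin_glb_lt; lra|apply Rmin_l]|].
    exists G. eapply Hmono; [apply Rmin_r|exact HG]. }
  specialize (HT1 _ HP1). assert (T < Rmin 1 R1) by (apply Rmin_glb_lt; lra). lra.
Qed.

End DiscLifting.

(** * Hurwitz densities *)

Lemma is_derive_on_domain (Y : C -> Prop) (g : C -> C) : holomorphic_on Y g ->
  forall z, Y z -> is_derive g z (C_derive g z).
Proof. intros H z Hz. apply (C_derive_correct g z z), H, Hz. Qed.

(** At [a] this is part of [good_map]. At any other point the sheet of the covering through [e] is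
    open and [g] is injective on it, so [injective_derivative_neq_0] applies. *)
Lemma good_map_derivative_neq_0 (Y1 Y2 : C -> Prop) (a b : C) (g : C -> C) :
  open Y1 -> good_map Y1 Y2 a b g -> forall e, Y1 e -> C_derive g e <> 0.
Proof.
  intros HY (Hhol & Hmaps & Hga & [l [Hl Hl0]] & [Hm [_ [_ Hcov]]]) e He.
  assert (HD := is_derive_on_domain Y1 g Hhol).
  destruct (Ceq_dec e a) as [->|Hne].
  { now rewrite (is_C_derive_unique g a l Hl). }
  destruct (Hcov (g e) (Hm e (conj He Hne))) as (V & HV & HVe & _ & J & U & HU & _ & HUA & Hhomeo).
  destruct (proj1 (HUA e) (conj (conj He Hne) HVe)) as [i Hi].
  destruct (Hhomeo i) as (finv & Hf1 & _).
  destruct (proj1 (open_C_iff _) (HU i) e Hi) as [r1 [Hr1 B1]].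
  destruct (proj1 (open_C_iff _) HY e He) as [r2 [Hr2 B2]].
  apply (injective_derivative_neq_0 g (C_derive g) e (Rmin r1 r2)).
  - apply Rmin_glb_lt; lra.
  - intros z Hz. apply HD, B2. eapply Rlt_le_trans; [exact Hz|apply Rmin_r].
  - intros z w Hz Hw E.
    rewrite <- (proj2 (Hf1 z (B1 z (Rlt_le_trans _ _ _ Hz (Rmin_l _ _))))), E.
    apply Hf1, B1. eapply Rlt_le_trans; [exact Hw|apply Rmin_l].
Qed.

Lemma good_map_local_inverse (Y1 Y2 : C -> Prop) (a b : C) (g : C -> C) :
  open Y1 -> good_map Y1 Y2 a b g -> forall e, Y1 e ->
  exists d m eta, 0 < d /\ 0 < m /\ 0 < eta /\ (forall z, Cmod (z - e) < d -> Y1 z) /\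
    (forall z w, Cmod (z - e) < d -> Cmod (w - e) < d -> m * Cmod (w - z) <= Cmod (g w - g z)) /\
    (forall y, Cmod (y - g e) < eta -> exists z, Cmod (z - e) < d /\ g z = y).
Proof.
  intros HY Hg e He.
  destruct (proj1 (open_C_iff _) HY e He) as [r [Hr B]].
  destruct (local_inverse g (C_derive g) e r Hr) as (d & m & eta & Hd & Hm & Heta & H1 & H2).
  - intros z Hz. apply (is_derive_on_domain Y1); [apply Hg|apply B, Hz].
  - eapply good_map_derivative_neq_0; eassumption.
  - exists d, m, eta. repeat split; try assumption; try lra. intros z Hz. apply B. lra.
Qed.

Lemma good_map_lift (Y1 Y2 : C -> Prop) (a b : C) (g f : C -> C) :
  open Y1 -> Y1 a -> good_map Y1 Y2 a b g -> Hset Defs.disc Y2 0 b f ->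
  exists F, Hset Defs.disc Y1 0 a F /\ forall z, Defs.disc z -> g (F z) = f z.
Proof.
  intros HY Ha Hg (Hfhol & Hfmaps & Hf0 & Hfne).
  assert (Hinj : forall e, Y1 e -> locally_injective_at g e).
  { intros e He.
    destruct (good_map_local_inverse Y1 Y2 a b g HY Hg e He) as (d & m & _ & Hd & Hm & _ & _ & H & _).
    exists d. split; [exact Hd|]. apply (local_inverse_injective g e d m Hm H). }
  assert (Hga : g a = b) by apply Hg.
  assert (Hdc : forall z, Defs.disc z -> continuous f z).
  { intros z Hz. apply ex_derive_C_continuous, Hfhol, Hz. }
  (* Near [zeta] the map [f] stays in one evenly covered set [V], so the lift through [e] is [finv]
     after [f], with [finv] the inverse of [g] on the sheet that contains [e]. *)
  assert (Hcover : forall zeta, 0 < Cmod zeta < 1 ->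
     exists d, 0 < d /\ evenly_covered g f Y1 zeta d).
  { intros zeta [Hz0 Hz1]. destruct Hg as (_ & _ & _ & _ & [_ [_ [_ Hcov]]]).
    destruct (Hcov (f zeta)) as (V & HV & HVz & HVB & J & U & _ & _ & HUA & Hhomeo).
    { split; [apply Hfmaps, Hz1|]. apply Hfne; [exact Hz1|]. intros E.
      rewrite E, Cmod_0 in Hz0. lra. }
    destruct (proj1 (open_C_iff _) HV _ HVz) as [e1 [He1 B1]].
    destruct (proj1 (continuous_C_iff _ _) (Hdc zeta Hz1) e1 He1) as [d1 [Hd1 D1]].
    set (d := Rmin d1 (1 - Cmod zeta)).
    assert (Hsub : forall z, Cmod (z - zeta) < d -> Defs.disc z /\ V (f z)).
    { intros z Hz. split.
      - assert (K := Cmod_triangle_inv z zeta). unfold Defs.disc.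
        assert (K2 := Rmin_r d1 (1 - Cmod zeta)). fold d in K2. lra.
      - apply B1, D1. eapply Rlt_le_trans; [exact Hz|apply Rmin_l]. }
    exists d. split; [apply Rmin_glb_lt; lra|].
    intros p e Hp He Hge. destruct (Hsub p Hp) as [_ HVp].
    assert (Hea : e <> a). { intros ->. apply (HVB _ HVp). congruence. }
    destruct (proj1 (HUA e)) as [i Hi].
    { split; [split; assumption|]. rewrite Hge. exact HVp. }
    destruct (Hhomeo i) as (finv & Hi1 & Hi2 & _ & Hi4).
    exists (fun z => finv (f z)). split.
    - rewrite <- Hge. apply Hi1, Hi.
    - intros z Hz. destruct (Hsub z Hz) as [Hdz HVz'].
      destruct (Hi2 _ HVz') as [HUz Hgz]. split; [|split].
      + apply (proj2 (HUA _)). now exists i.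
      + exact Hgz.
      + apply (continuous_comp f finv); [apply Hdc, Hdz|apply Hi4, HVz']. }
  (* Around [0] no sheet is available; the local inverse of [g] at [a] takes its place, and its
     expansion constant [m] gives the continuity of the lift. *)
  assert (Hinit : exists r, 0 < r /\ exists F, is_disc_lift g f Y1 a r F).
  { destruct (good_map_local_inverse Y1 Y2 a b g HY Hg a Ha)
      as (d & m & eta & Hd & Hm & Heta & HB & Hlip & Hsurj).
    assert (H0 : Defs.disc 0) by (unfold Defs.disc; rewrite Cmod_0; lra).
    destruct (proj1 (continuous_C_iff _ _) (Hdc 0 H0) eta Heta) as [r [Hr Dr]].
    assert (Hz : forall z : C, exists w, Cmod z < Rmin r 1 -> Cmod (w - a) < d /\ g w = f z).
    { intros z. destruct (Rlt_dec (Cmod z) (Rmin r 1)) as [Hz|Hz].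
      2:{ exists 0. tauto. }
      destruct (Hsurj (f z)) as [w Hw].
      - rewrite Hga, <- Hf0. apply Dr. replace (z - 0)%C with z by ring.
        eapply Rlt_le_trans; [exact Hz|apply Rmin_l].
      - exists w. intros _. exact Hw. }
    set (F := fun z => proj1_sig (constructive_indefinite_description _ (Hz z))).
    assert (HF : forall z, Cmod z < Rmin r 1 -> Cmod (F z - a) < d /\ g (F z) = f z).
    { intros z. exact (proj2_sig (constructive_indefinite_description _ (Hz z))). }
    assert (Hr1 : 0 < Rmin r 1) by (apply Rmin_glb_lt; lra).
    exists (Rmin r 1). split; [exact Hr1|]. exists F. split.
    - destruct (HF 0) as [F1 F2]; [rewrite Cmod_0; exact Hr1|].
      apply (local_inverse_injective g a d m Hm Hlip); [exact F1|rewrite Cmod_minus_0; lra|congruence].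
    - intros z Hzr. destruct (HF z Hzr) as [F1 F2].
      split; [apply HB, F1|split; [exact F2|]].
      assert (Hzd : Defs.disc z) by (unfold Defs.disc; assert (K := Rmin_r r 1); lra).
      apply continuous_C_iff. intros e He.
      assert (Hem : 0 < m * e) by (apply Rmult_lt_0_compat; lra).
      destruct (proj1 (continuous_C_iff _ _) (Hdc z Hzd) (m * e) Hem) as [s [Hs Ds]].
      exists (Rmin s (Rmin r 1 - Cmod z)). split; [apply Rmin_glb_lt; lra|]. intros y Hy.
      assert (K := Cmod_triangle_inv y z).
      assert (Hy2 := Rlt_le_trans _ _ _ Hy (Rmin_r _ _)).
      destruct (HF y) as [G1 G2]; [lra|].
      specialize (Ds y (Rlt_le_trans _ _ _ Hy (Rmin_l _ _))).
      specialize (Hlip (F z) (F y) F1 G1). rewrite F2, G2 in Hlip.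
      apply (Rmult_lt_reg_l m); lra. }
  destruct Hinit as [r [Hr HF0]].
  destruct (disc_lift_exists g f Y1 a Hinj Hcover r Hr HF0) as [F [Fa HF]].
  exists F. split; [|intros z Hz; apply HF, Hz]. repeat split.
  - intros z Hz. destruct (HF z Hz) as (F1 & F2 & F3). destruct (Hfhol z Hz) as [lf Hlf].
    exists (lf / C_derive g (F z))%C. apply (is_derive_lift g f F z (C_derive g (F z)) lf (1 - Cmod z)).
    + unfold Defs.disc in Hz. lra.
    + intros y Hy. apply HF. assert (K := Cmod_triangle_inv y z). lra.
    + exact F3.
    + exact Hlf.
    + apply (is_derive_on_domain Y1); [apply Hg|exact F1].
    + eapply good_map_derivative_neq_0; eassumption.
  - intros z Hz. apply HF, Hz.
  - exact Fa.
  (* If [F z = a] then [f z = g a = b], which is excluded for [z <> 0]. *)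
  - intros z Hz Hz0 E. apply (Hfne z Hz Hz0). destruct (HF z Hz) as (_ & F2 & _). congruence.
Qed.

Lemma Hset_comp_good_map (Omega Y1 Y2 : C -> Prop) (w a b : C) (g h : C -> C) :
  good_map Y1 Y2 a b g -> Hset Omega Y1 w a h -> Hset Omega Y2 w b (fun z => g (h z)).
Proof.
  intros (Hhol & Hmaps & Hga & _ & [Hcm _]) (H1 & H2 & H3 & H4). repeat split.
  - intros z Hz. destruct (H1 z Hz) as [lh Hlh]. destruct (Hhol (h z) (H2 z Hz)) as [lg Hlg].
    eexists. apply (is_derive_C_comp g h); eassumption.
  - intros z Hz. apply Hmaps, H2, Hz.
  - congruence.
  - intros z Hz Hzw. apply (Hcm (h z)). split; [apply H2|apply H4]; assumption.
Qed.

(** * Rotations of the disc and the scaling of [r_Y] *)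

Lemma Hset_rotate (Y : C -> Prop) (v u : C) (h : C -> C) : Cmod u = 1 ->
  Hset Defs.disc Y 0 v h -> Hset Defs.disc Y 0 v (fun z => h (u * z)%C).
Proof.
  intros Hu (H1 & H2 & H3 & H4).
  assert (Hd : forall z, Defs.disc z -> Defs.disc (u * z)%C).
  { intros z Hz. unfold Defs.disc. rewrite Cmod_mult, Hu, Rmult_1_l. exact Hz. }
  assert (Hu0 : u <> 0) by (apply Cmod_gt_0; lra).
  repeat split.
  - intros z Hz. destruct (H1 _ (Hd z Hz)) as [l Hl]. eexists.
    apply (is_derive_C_comp h (fun z => u * z)%C); [exact Hl|].
    apply (is_derive_C_ext_loc (fun y : C => 0 + u * y)%C _ _ _ 1); [lra|intros; ring|apply is_derive_C_affine].
  - intros z Hz. apply H2, Hd, Hz.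
  - rewrite Cmult_0_r. exact H3.
  - intros z Hz Hz0. apply H4; [apply Hd, Hz|]. apply Cmult_neq_0; assumption.
Qed.

Lemma is_derive_rotate (u l : C) (h : C -> C) : is_derive h (RtoC 0) l ->
  is_derive (fun z => h (u * z)%C) (RtoC 0) (u * l)%C.
Proof.
  intros H. apply (is_derive_C_comp h (fun z => u * z)%C); [rewrite Cmult_0_r; exact H|].
  apply (is_derive_C_ext_loc (fun y : C => 0 + u * y)%C _ _ _ 1); [lra|intros; ring|apply is_derive_C_affine].
Qed.

(** Multiplication by [m] matches the two sets and hence their upper bounds. In the infinite cases
    both suprema are the same infinity, which [real] sends to [0 = m * 0]. *)
Lemma real_Lub_Rbar_scale (S1 S2 : R -> Prop) (m : R) : 0 < m ->
  (forall x, S1 x -> S2 (m * x)) -> (forall x, S2 x -> S1 (x / m)) ->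
  real (Lub_Rbar S2) = m * real (Lub_Rbar S1).
Proof.
  intros Hm H12 H21. destruct (Lub_Rbar_correct S1) as [U1 L1].
  assert (Hub : forall c : R, is_ub_Rbar S2 c -> is_ub_Rbar S1 (c / m)).
  { intros c Hc x Hx. specialize (Hc _ (H12 x Hx)). simpl in *. apply Rle_div_r; lra. }
  assert (HubM : is_ub_Rbar S2 m_infty -> is_ub_Rbar S1 m_infty).
  { intros Hc x Hx. exact (Hc _ (H12 x Hx)). }
  destruct (Lub_Rbar S1) as [r| |] eqn:E1.
  - rewrite (is_lub_Rbar_unique S2 (m * r)); [reflexivity|]. split.
    + intros x Hx. specialize (U1 _ (H21 x Hx)). simpl in *. apply Rle_div_l in U1; lra.
    + intros [c| |] Hc; simpl; [|trivial|].
      * specialize (L1 _ (Hub c Hc)). simpl in L1. apply Rle_div_r in L1; lra.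
      * exact (L1 _ (HubM Hc)).
  - rewrite (is_lub_Rbar_unique S2 p_infty); [simpl; ring|]. split.
    + intros x _. exact I.
    + intros [c| |] Hc; simpl; [|trivial|].
      * exact (L1 _ (Hub c Hc)).
      * exact (L1 _ (HubM Hc)).
  - rewrite (is_lub_Rbar_unique S2 m_infty); [simpl; ring|]. split.
    + intros x Hx. exact (U1 _ (H21 x Hx)).
    + intros c _. destruct c; simpl; trivial.
Qed.

(** Composing with [g] gives derivative [x * l], and lifting gives [x / l]; neither need be
    positive. The rotations by [Cmod l / l] and [l / Cmod l] turn them into [Cmod l * x] and
    [x / Cmod l]. *)
Lemma r_Y_good_map (Y1 Y2 : C -> Prop) (a b l : C) (g : C -> C) :
  open Y1 -> Y1 a -> good_map Y1 Y2 a b g -> is_derive g a l -> l <> 0 ->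
  r_Y Y2 b = Cmod l * r_Y Y1 a.
Proof.
  intros HY Ha Hg Hl Hl0. assert (Hm := proj1 (Cmod_gt_0 l) Hl0).
  assert (HmC : RtoC (Cmod l) <> 0) by (intros E; apply RtoC_inj in E; lra).
  assert (Hmm : Cmod (RtoC (Cmod l)) = Cmod l) by (rewrite Cmod_R; apply Rabs_pos_eq; lra).
  apply real_Lub_Rbar_scale; [exact Hm| |].
  - intros x (h & Hh & Hx & Dh).
    exists (fun z => g (h (RtoC (Cmod l) / l * z)%C)). split; [|split].
    + apply (Hset_comp_good_map Defs.disc Y1 Y2 0 a b g (fun z => h (Cmod l / l * z)%C) Hg).
      apply Hset_rotate; [|exact Hh]. rewrite Cmod_div, Hmm by exact Hl0. field. lra.
    + apply Rmult_lt_0_compat; assumption.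
    + replace (RtoC (Cmod l * x)) with (Cmod l / l * x * l)%C by (rewrite RtoC_mult; field; exact Hl0).
      apply (is_derive_C_comp g (fun z => h (Cmod l / l * z)%C)); [|apply is_derive_rotate, Dh].
      rewrite Cmult_0_r. destruct Hh as (_ & _ & -> & _). exact Hl.
  - intros x (f & Hf & Hx & Df).
    destruct (good_map_lift Y1 Y2 a b g f HY Ha Hg Hf) as (F & HF & HgF).
    exists (fun z => F (l / RtoC (Cmod l) * z)%C). split; [|split].
    + apply Hset_rotate; [|exact HF]. rewrite Cmod_div, Hmm by exact HmC. field. lra.
    + apply Rdiv_lt_0_compat; assumption.
    + replace (RtoC (x / Cmod l)) with (l / Cmod l * (x / l))%C
        by (rewrite RtoC_div by lra; field; split; assumption).
      apply is_derive_rotate. destruct HF as (F1 & _ & F3 & _).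
      apply (is_derive_lift g f F 0 l x 1).
      * lra.
      * intros y Hy. apply HgF. unfold Defs.disc. replace y with (y - 0)%C by ring. exact Hy.
      * apply ex_derive_C_continuous, F1. unfold Defs.disc. rewrite Cmod_0. lra.
      * exact Df.
      * rewrite F3. exact Hl.
      * exact Hl0.
Qed.

(* If [r_Y] is the junk value [0] (infinite supremum), both sides are [0] since [2 / 0 = 0]. *)
Lemma eta_Y_good_map (Y1 Y2 : C -> Prop) (a b l : C) (g : C -> C) :
  open Y1 -> Y1 a -> good_map Y1 Y2 a b g -> is_derive g a l -> l <> 0 ->
  eta_Y Y1 a = eta_Y Y2 b * Cmod l.
Proof.
  intros HY Ha Hg Hl Hl0. unfold eta_Y. rewrite (r_Y_good_map Y1 Y2 a b l g) by assumption.
  assert (Hm := proj1 (Cmod_gt_0 l) Hl0). unfold Rdiv. rewrite Rinv_mult.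
  replace (2 * (/ Cmod l * / r_Y Y1 a) * Cmod l) with (2 * / r_Y Y1 a * (/ Cmod l * Cmod l)) by ring.
  rewrite Rinv_l by lra. ring.
Qed.

Theorem theorem3p14 (Y1 Y2 Omega : C -> Prop) :
  is_domain Y1 -> proper_subset Y1 ->
  is_domain Y2 -> proper_subset Y2 ->
  is_domain Omega ->
  (forall b, Y2 b -> exists a, Y1 a /\ exists g, good_map Y1 Y2 a b g) ->
  forall b a, Y2 b -> Y1 a -> (exists g, good_map Y1 Y2 a b g) ->
  forall w, Omega w -> Rbar_le (cara Omega Y1 a w) (cara Omega Y2 b w).
Proof.
  intros [HY1 _] _ _ _ _ _ b a _ Ha [g Hg] w Hw.
  assert (Hg' := Hg). destruct Hg' as (_ & _ & Hga & [l [Hl Hl0]] & _).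
  assert (Heta := eta_Y_good_map Y1 Y2 a b l g HY1 Ha Hg Hl Hl0).
  assert (Hmem : forall h lh, Hset Omega Y1 w a h -> is_derive h w lh ->
    Hset Omega Y2 w b (fun z => g (h z)) /\ is_derive (fun z => g (h z)) w (lh * l)%C).
  { intros h lh Hh Dh. split; [now apply (Hset_comp_good_map Omega Y1 Y2 w a b g h)|].
    apply (is_derive_C_comp g h); [|exact Dh]. destruct Hh as (_ & _ & -> & _). exact Hl. }
  unfold cara.
  destruct (excluded_middle_informative (exists h, Hset Omega Y1 w a h)) as [[h0 Hh0]|_].
  - destruct (excluded_middle_informative (exists h, Hset Omega Y2 w b h)) as [_|HN].
    + apply Lub_Rbar_correct. intros x (h & lh & Hh & Dh & ->).
      destruct (Hmem h lh Hh Dh) as [Hh2 Dh2]. apply Lub_Rbar_correct.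
      exists (fun z => g (h z)), (lh * l)%C. split; [exact Hh2|]. split; [exact Dh2|].
      destruct Hh as (_ & _ & -> & _). rewrite Hga, Heta, Cmod_mult. ring.
    + exfalso. apply HN. exists (fun z => g (h0 z)).
      now apply (Hset_comp_good_map Omega Y1 Y2 w a b g h0).
  (* The left side is the default value [0], so it remains to see that one member of the right-hand
     set is nonnegative, that is, that [eta_Y Y2 b >= 0]. *)
  - destruct (excluded_middle_informative (exists h, Hset Omega Y2 w b h)) as [[h Hh]|_].
    2:{ apply Rbar_le_refl. }
    assert (Hh' := Hh). destruct Hh' as (H1 & _ & E & _). destruct (H1 w Hw) as [lh Dh].
    apply Rbar_le_trans with (eta_Y Y2 (h w) * Cmod lh).
    2:{ apply Lub_Rbar_correct. exists h, lh. now split. }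
    simpl. apply Rmult_le_pos; [|apply Cmod_ge_0]. rewrite E. unfold eta_Y.
    assert (Hr : 0 <= r_Y Y2 b).
    { unfold r_Y. set (S := fun x : R => _). destruct (Lub_Rbar_correct S) as [U L].
      destruct (Lub_Rbar S) as [r| |]; simpl; try lra.
      (* The set contains only positive numbers, so a negative upper bound would make it empty; then
         [m_infty] would be an upper bound below the finite supremum [r]. *)
      apply Rnot_lt_le. intros Hneg. specialize (L m_infty). simpl in L. apply L.
      intros x Hx. specialize (U x Hx). destruct Hx as (_ & _ & Hx & _). simpl in *. lra. }
    unfold Rdiv. destruct Hr as [Hr|<-].
    + left. apply Rmult_lt_0_compat; [lra|now apply Rinv_0_lt_compat].
    (* When [r_Y Y2 b = 0] the density is [2 / 0 = 0]. *)
    + rewrite Rinv_0. lra.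
Qed.
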